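(* For any virtual (or classical) knot $K$, $$\mathrm{u}_{\mathrm{v}}(K)\leq 2\, \mathrm{u}(K).$$
   Context: A virtual knot diagram is a generic closed curve in the plane each of whose double points is either a classical crossing (over/under information given) or a virtual crossing (circled, no over/under information). A virtual knot is an equivalence class of such diagrams under planar isotopy, the classical Reidemeister moves and the virtual Reidemeister moves; equivalently, planar isotopy, the classical Reidemeister moves and the detour move (a strand containing no classical crossings may be replaced by any other strand with the same endpoints and no classical crossings, all new double points being virtual). The unknot is the class of the crossingless circle. The unknotting number $\mathrm{u}(D)$ of a diagram $D$ is the minimum number of classical crossings whose local writhes must be switched so that the resulting diagram is a diagram of the unknot (taken to be $\infty$ if this is impossible), and $\mathrm{u}(K)=\min_D \mathrm{u}(D)$ over all diagrams $D$ of $K$. The virtual unknotting number $\mathrm{u}_{\mathrm{v}}(D)$ is the minimum number of classical crossings of $D$ that must be made virtual so that the resulting diagram is a diagram of the unknot, and $\mathrm{u}_{\mathrm{v}}(K)=\min_D \mathrm{u}_{\mathrm{v}}(D)$ over all diagrams $D$ of $K$. *)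

(* Defs.v *)
From HB Require Import structures.
From mathcomp Require Import all_boot all_order all_algebra.
From mathcomp Require Import all_classical all_reals all_analysis.
From Stdlib Require Import Relation_Operators.

Set Implicit Arguments.
Unset Strict Implicit.
Unset Printing Implicit Defensive.

Import Order.TTheory GRing.Theory Num.Theory.
Import numFieldNormedType.Exports.

Local Open Scope classical_set_scope.
Local Open Scope ring_scope.

(** Virtual knot diagrams as tame topological closed curves in the plane.

    The circle is R/Z and a closed curve is a 1-periodic map [R -> R * R], so
    two parameters name the same point of the circle iff they differ by an
    integer. The crossing information is a relation between parameters:
    [passes_over s t] says that [s] and [t] are the two parameters of a
    classical crossing and that the strand through [s] is the upper one. A
    double point related in neither direction is a virtual crossing. *)

Section Plane.
Variable R : realType.

Local Notation plane := (R * R)%type.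

Definition same_param (s t : R) : Prop := s - t \is a Num.int.

(* Not required to preserve the orientation of the plane. *)
Definition homeo (f : plane -> plane) : Prop :=
  continuous f /\
  exists g : plane -> plane, [/\ continuous g, cancel f g & cancel g f].

Definition square : set plane :=
  [set p | - 1 <= p.1 <= 1 /\ - 1 <= p.2 <= 1].

(* A picture drawn in [square]: k arcs, each parametrized by [-1, 1]; values
   outside [-1, 1] are irrelevant. *)
Definition picture (k : nat) : Type := k.-tuple (R -> plane).

(* The part of the curve [c] lying in the closed disc [phi @` square] is the
   image under [phi] of the picture [T], the i-th arc of [T] being traversed by
   the parameters [tau i u], -1 <= u <= 1, in either direction. *)
Definition looks_like (c : R -> plane) (k : nat) (T : picture k)
    (phi : plane -> plane) (tau : 'I_k -> R -> R) : Prop :=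
  [/\ homeo phi,
      forall i, {within `[- 1, 1], continuous (tau i)},
      forall i u, u \in `[- 1, 1] -> c (tau i u) = phi (tnth T i u),
      forall i j u v, u \in `[- 1, 1] -> v \in `[- 1, 1] ->
        same_param (tau i u) (tau j v) -> i = j /\ u = v
    & forall s, (phi @` square) (c s) ->
        exists i u, u \in `[- 1, 1] /\ same_param s (tau i u)].

Definition crossing_picture : picture 2 :=
  [tuple fun u => (u, 0); fun u => (0, u)].

Definition double_pair (c : R -> plane) (s t : R) : Prop :=
  c s = c t /\ ~ same_param s t.

(* The last clause says that every double point is a transversal crossing of
   exactly two strands: near it the curve looks like two crossing segments. *)
Definition generic_closed_curve (c : R -> plane) : Prop :=
  [/\ continuous c,
      forall t, c (t + 1) = c t,
      finite_set [set p | exists s t, double_pair c s t /\ p = c s]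
    & forall s t, double_pair c s t ->
        exists phi tau, looks_like c crossing_picture phi tau /\
                        phi (0, 0) = c s].

Record diagram : Type := Diagram {
  curve : R -> plane;
  passes_over : R -> R -> Prop;
  curve_generic : generic_closed_curve curve;
  passes_over_double : forall s t, passes_over s t -> double_pair curve s t;
  passes_over_asym : forall s t, passes_over s t -> ~ passes_over t s;
  passes_over_param : forall s s' t t', same_param s s' -> same_param t t' ->
    passes_over s t -> passes_over s' t' }.

Definition classical_crossings (D : diagram) : set plane :=
  [set p | exists s t, passes_over D s t /\ p = curve D s].

Definition circle_homeo (rho : R -> R) : Prop :=
  [/\ continuous rho, injective rho
    & (forall t, rho (t + 1) = rho t + 1) \/
      (forall t, rho (t + 1) = rho t - 1)].

Definition plane_isotopy (H : R -> plane -> plane) : Prop :=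
  [/\ {within [set z : R * plane | 0 <= z.1 <= 1],
         continuous (fun z => H z.1 z.2)},
      forall t, t \in `[0, 1] -> homeo (H t)
    & forall p, H 0 p = p].

(* Planar isotopy of the underlying unparametrized, unoriented curves. *)
Definition planar_isotopic (D D' : diagram) : Prop :=
  exists H rho, [/\ plane_isotopy H, circle_homeo rho,
    forall t, curve D' t = H 1 (curve D (rho t))
  & forall s t, passes_over D' s t <-> passes_over D (rho s) (rho t)].

(* At each crossing of a picture, the point that comes first for the
   lexicographic order (number of the arc, then parameter) is the upper one. *)
Definition picture_over (k : nat) (T : picture k) (i : 'I_k) (u : R)
    (j : 'I_k) (v : R) : Prop :=
  tnth T i u = tnth T j v /\ ((i < j)%N \/ i = j /\ u < v).

Definition drawn_as (D : diagram) (k : nat) (T : picture k)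
    (phi : plane -> plane) (tau : 'I_k -> R -> R) : Prop :=
  looks_like (curve D) T phi tau /\
  forall i j u v, u \in `[- 1, 1] -> v \in `[- 1, 1] ->
    (passes_over D (tau i u) (tau j v) <-> picture_over T i u j v).

Definition agree_on (A : set R) (D D' : diagram) : Prop :=
  (forall s, A s -> curve D' s = curve D s) /\
  (forall s t, A s -> A t -> (passes_over D' s t <-> passes_over D s t)).

(* Replace the picture T by T' in the disc [phi @` square]. *)
Definition local_move (k : nat) (T T' : picture k) (D D' : diagram) : Prop :=
  exists phi tau, [/\ drawn_as D T phi tau, drawn_as D' T' phi tau
    & agree_on [set s | ~ exists i u, u \in `[- 1, 1] /\
                                      same_param s (tau i u)] D D'].

(* Because [phi] may reverse the orientation of the plane, and [tau] that of
   the arcs, one picture per move accounts for all its variants. The kink of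
   R1 has its only double point at u = -1/sqrt 2 and u = 1/sqrt 2. *)
Definition R1_left : picture 1 := [tuple fun u => (u, 0)].
Definition R1_right : picture 1 :=
  [tuple fun u => (2 * u ^+ 3 - u, (1 - u ^+ 2) / 2)].

Definition R2_left : picture 2 :=
  [tuple fun u => (u, 2^-1); fun u => (u, - 2^-1)].
Definition R2_right : picture 2 :=
  [tuple fun u => (u, `|u| - 2^-1); fun u => (u, 2^-1 - `|u|)].

Definition R3_left : picture 3 :=
  [tuple fun u => (- ((1 - `|u|) / 2), u);
         fun u => (u, u / 2); fun u => (u, - (u / 2))].
Definition R3_right : picture 3 :=
  [tuple fun u => ((1 - `|u|) / 2, u);
         fun u => (u, u / 2); fun u => (u, - (u / 2))].

(* The strand is the arc of parameters [a, b]. As it carries no classical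
   crossing before or after the move, [passes_over] is literally unchanged. *)
Definition detour_move (D D' : diagram) : Prop :=
  exists a b, [/\ a < b < a + 1,
    forall D0 s t, D0 = D \/ D0 = D' -> a <= s <= b ->
      ~ passes_over D0 s t /\ ~ passes_over D0 t s,
    forall s, b <= s <= a + 1 -> curve D' s = curve D s
  & forall s t, passes_over D' s t <-> passes_over D s t].

Definition move (D D' : diagram) : Prop :=
  [\/ planar_isotopic D D', local_move R1_left R1_right D D',
      local_move R2_left R2_right D D' | local_move R3_left R3_right D D'] \/
  detour_move D D'.

Definition equivalent : diagram -> diagram -> Prop :=
  clos_refl_sym_trans diagram move.

Definition is_virtual_knot (K : set diagram) : Prop :=
  exists D, K = [set D' | equivalent D D'].

Definition round_circle (t : R) : plane :=
  (cos (pi * t *+ 2), sin (pi * t *+ 2)).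

Lemma round_circle_inj s t :
  round_circle s = round_circle t -> same_param s t.
Proof.
rewrite /round_circle /same_param => -[hc hs].
have h1 : cos (pi * (s - t) *+ 2) = 1.
  by rewrite mulrBr mulrnBl cosB hc hs -!expr2 cos2Dsin2.
set m := Num.floor (s - t); set r := s - t - m%:~R.
have hz (z : int) : sin (pi * z%:~R : R) = 0.
  have hn (n : nat) : sin (pi * n%:R : R) = 0.
    elim: n => [|n IH]; first by rewrite mulr0 sin0.
    by rewrite -natr1 mulrDr mulr1 sinD IH sinpi mul0r mulr0 addr0.
  case: z => n; first exact: hn.
  by rewrite NegzE mulrNz mulrN sinN -pmulrn hn oppr0.
have h0 : sin (pi * (s - t)) = 0.
  move: h1; rewrite cos_mulr2n => h1.
  have := cos2Dsin2 (pi * (s - t)).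
  have -> : cos (pi * (s - t)) ^+ 2 = 1.
    apply: (@mulIf R 2); first by rewrite pnatr_eq0.
    by apply/eqP; rewrite mulr_natr mul1r -subr_eq0 -[X in _ - X]/(1 + 1) opprD addrA h1 subrr.
  by move/eqP; rewrite -subr_eq0 addrC addKr sqrf_eq0 => /eqP.
have hr : sin (pi * r) = 0.
  by rewrite /r mulrBr sinB h0 hz mulr0 mul0r subrr.
have r0 : 0 <= r by rewrite subr_ge0 floor_le.
have r1 : r < 1 by rewrite ltrBlDl -[1]/(1%:~R) -intrD floorD1_gt.
have [re|rn] := eqVneq r 0; first by move/eqP: re; rewrite subr_eq0 => /eqP ->; exact: intr_int.
have : 0 < sin (pi * r).
  apply: sin_gt0_pi; rewrite mulr_gt0 ?pi_gt0 ?lt0r ?rn//=.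
  by rewrite gtr_pMr ?pi_gt0.
by rewrite hr ltxx.
Qed.

Lemma round_circle_generic : generic_closed_curve round_circle.
Proof.
have nd s t : ~ double_pair round_circle s t.
  by move=> [/round_circle_inj h]; apply.
split.
- have ca : continuous (fun t : R => pi * t *+ 2).
    by move=> t; apply: cvgMn; apply: cvgMr; exact: cvg_id.
  have cc : continuous (fun t : R => cos (pi * t *+ 2)).
    by move=> t; apply: (continuous_comp (ca t)); exact: continuous_cos.
  have cs : continuous (fun t : R => sin (pi * t *+ 2)).
    by move=> t; apply: (continuous_comp (ca t)); exact: continuous_sin.
  by move=> t; exact: (cvg_pair (cc t) (cs t)).
- by move=> t; rewrite /round_circle mulrDr mulr1 mulrnDl cosD2pi sinD2pi.
- rewrite (_ : [set _ | _] = set0); first exact: finite_set0.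
  by rewrite -subset0 => p [s [t [/nd]]].
- by move=> s t /nd.
Qed.

Definition unknot : diagram :=
  @Diagram round_circle (fun _ _ => False) round_circle_generic
    (fun _ _ => False_ind _) (fun _ _ _ => id) (fun _ _ _ _ _ _ => id).

Definition is_unknot (D : diagram) : Prop := equivalent unknot D.

(** A crossing is given by its position in the plane. *)

Section Change.
Variables (D : diagram) (S : set plane).

Definition switched_over (s t : R) : Prop :=
  (~ S (curve D s) /\ passes_over D s t) \/
  (S (curve D s) /\ passes_over D t s).

Lemma curve_same_param s t : same_param s t -> curve D s = curve D t.
Proof.
have [_ per _ _] := curve_generic D.
have pern (n : nat) x : curve D (x + n%:R) = curve D x.
  by elim: n => [|n IH]; rewrite ?addr0// -natr1 addrA per.
move=> /intrP[z hz]; have -> : s = t + z%:~R by rewrite -hz addrC subrK.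
case: z {hz} => n; first exact: pern.
by rewrite NegzE mulrNz -pmulrn -[LHS](pern n.+1) subrK.
Qed.

Lemma switched_over_double s t :
  switched_over s t -> double_pair (curve D) s t.
Proof.
move=> [[_ /passes_over_double//]|[_ /passes_over_double[e n]]].
by split=> // h; apply: n; rewrite /same_param -opprB rpredN.
Qed.

Lemma switched_over_asym s t : switched_over s t -> ~ switched_over t s.
Proof.
move=> h; have [e _] := switched_over_double h.
move: h; rewrite /switched_over e.
by move=> [[h /passes_over_asym o]|[h /passes_over_asym o]] [[]|[]].
Qed.

Lemma switched_over_param s s' t t' : same_param s s' -> same_param t t' ->
  switched_over s t -> switched_over s' t'.
Proof.
move=> hs ht; rewrite /switched_over (curve_same_param hs).
by move=> [[h o]|[h o]]; [left|right]; split=> //;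
  apply: passes_over_param o.
Qed.

Definition switch_crossings : diagram :=
  Diagram (curve_generic D) switched_over_double switched_over_asym
    switched_over_param.

Definition kept_over (s t : R) : Prop :=
  ~ S (curve D s) /\ passes_over D s t.

Lemma kept_over_double s t : kept_over s t -> double_pair (curve D) s t.
Proof. by move=> [_ /passes_over_double]. Qed.

Lemma kept_over_asym s t : kept_over s t -> ~ kept_over t s.
Proof. by move=> [_ /passes_over_asym o] []. Qed.

Lemma kept_over_param s s' t t' : same_param s s' -> same_param t t' ->
  kept_over s t -> kept_over s' t'.
Proof.
move=> hs ht; rewrite /kept_over (curve_same_param hs) => -[h o].
by split=> //; apply: passes_over_param o.
Qed.

Definition virtualize_crossings : diagram :=
  Diagram (curve_generic D) kept_over_double kept_over_asym kept_over_param.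

End Change.

(** Unknotting numbers, as extended reals: the infimum of a nonempty set of
    natural numbers is its minimum, and the infimum of the empty set is +oo. *)

Definition min_number (change : diagram -> set plane -> diagram)
    (D : diagram) : \bar R :=
  ereal_inf [set x | exists (n : nat) (S : set plane),
    [/\ S `<=` classical_crossings D, (S #= `I_n)%card,
        is_unknot (change D S) & x = (n%:R)%:E]].

Definition unknotting_number_diagram := min_number switch_crossings.
Definition virtual_unknotting_number_diagram :=
  min_number virtualize_crossings.

Definition unknotting_number (K : set diagram) : \bar R :=
  ereal_inf (unknotting_number_diagram @` K).
Definition virtual_unknotting_number (K : set diagram) : \bar R :=
  ereal_inf (virtual_unknotting_number_diagram @` K).

End Plane.

(* Main.v *)
(** Next to a crossing p to be switched, at which the strand A passes over the
    strand B, an R2 move adds two crossings q, r at which B passes over A, so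
    that the two strands now meet in p, q, r. Make p and q virtual: the two
    strands then bound a bigon with only virtual crossings, which detours remove,
    and one crossing r of A and B with B on top is left, as after switching p.
    Each switch thus costs two virtualizations. As all this happens in a disc
    around p, the crossings can be treated one at a time.

    The disc is drawn so that A and B are the graphs of f and - f over [-1, 1]
    for piecewise linear functions f, so that redrawing the strands amounts to
    changing the second coordinate of the curve. In these coordinates r is not
    at the place of p; the remaining discrepancy is bridged by another pair of
    R2 moves, which adds two crossings on one side of a crossing and cancels
    it with one of them, leaving the other. *)

Require Import Defs.
From mathcomp Require Import all_boot all_order all_algebra.
From mathcomp Require Import all_classical all_reals all_analysis.
From mathcomp Require Import zify ring lra.
From Stdlib Require Import Relation_Operators.

Set Implicit Arguments.
Unset Strict Implicit.
Unset Printing Implicit Defensive.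

Import Order.TTheory GRing.Theory Num.Theory.
Import numFieldNormedType.Exports.

Local Open Scope classical_set_scope.
Local Open Scope ring_scope.

(** * Continuity of explicitly given functions *)

Section RealContinuity.
Variables (R : realType) (T : topologicalType).
Implicit Types f g : T -> R.

Lemma continuous_add f g :
  continuous f -> continuous g -> continuous (fun x => f x + g x).
Proof. by move=> cf cg x; apply: cvgD; [exact: cf|exact: cg]. Qed.

Lemma continuous_opp f : continuous f -> continuous (fun x => - f x).
Proof. by move=> cf x; apply: cvgN; exact: cf. Qed.

Lemma continuous_mul f g :
  continuous f -> continuous g -> continuous (fun x => f x * g x).
Proof. by move=> cf cg x; apply: cvgM; [exact: cf|exact: cg]. Qed.

Lemma continuous_norm f : continuous f -> continuous (fun x => `|f x|).
Proof. by move=> cf x; apply: cvg_norm; exact: cf. Qed.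

Lemma continuous_max f g :
  continuous f -> continuous g -> continuous (fun x => Num.max (f x) (g x)).
Proof.
move=> cf cg x.
exact: (@continuous2_cvg _ _ _ _ _ _ f g Num.max _ _
  (@max_continuous _ R (f x, g x)) (cf x) (cg x)).
Qed.

Lemma continuous_min f g :
  continuous f -> continuous g -> continuous (fun x => Num.min (f x) (g x)).
Proof.
move=> cf cg x.
exact: (@continuous2_cvg _ _ _ _ _ _ f g Num.min _ _
  (@min_continuous _ R (f x, g x)) (cf x) (cg x)).
Qed.

Lemma continuous_inv f :
  (forall x, f x != 0) -> continuous f -> continuous (fun x => (f x)^-1).
Proof. by move=> f0 cf x; exact: (continuousV (f0 x) (cf x)). Qed.

Lemma continuous_pair f g :
  continuous f -> continuous g -> continuous (fun x => (f x, g x)).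
Proof. by move=> cf cg x; exact: (cvg_pair (cf x) (cg x)). Qed.

End RealContinuity.

Lemma continuous_id (T : topologicalType) : continuous (fun x : T => x).
Proof. by move=> x; exact: cvg_id. Qed.

Lemma continuous_fst (T U : topologicalType) :
  continuous (fun p : T * U => p.1).
Proof. by move=> p; exact: cvg_fst. Qed.

Lemma continuous_snd (T U : topologicalType) :
  continuous (fun p : T * U => p.2).
Proof. by move=> p; exact: cvg_snd. Qed.

Lemma continuous_const (T U : topologicalType) (a : U) :
  continuous (fun _ : T => a).
Proof. by move=> p; exact: cvg_cst. Qed.

Lemma continuous_after (T U V : topologicalType) (f : T -> U) (g : U -> V) :
  continuous f -> continuous g -> continuous (fun x => g (f x)).
Proof. by move=> cf cg x; exact: (continuous_comp (cf x) (cg (f x))). Qed.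

Ltac continuity := repeat lazymatch goal with |- continuous ?F =>
  lazymatch F with
  | (fun x => x) => exact (@continuous_id _)
  | (fun x => x.1) => exact (@continuous_fst _ _)
  | (fun x => x.2) => exact (@continuous_snd _ _)
  | (fun x => (@?f x, @?g x)) => apply (@continuous_pair _ _ f g)
  | (fun x => @?f x + @?g x) => apply (@continuous_add _ _ f g)
  | (fun x => - @?f x) => apply (@continuous_opp _ _ f)
  | (fun x => @?f x * @?g x) => apply (@continuous_mul _ _ f g)
  | (fun x => `|@?f x|) => apply (@continuous_norm _ _ f)
  | (fun x => Num.max (@?f x) (@?g x)) => apply (@continuous_max _ _ f g)
  | (fun x => Num.min (@?f x) (@?g x)) => apply (@continuous_min _ _ f g)
  | (fun _ => ?a) => exact (@continuous_const _ _ a)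
  end
end.

Lemma within_continuous_after (T U V : topologicalType) (A : set T)
    (B : set U) (f : T -> U) (g : U -> V) :
  continuous f -> (forall x, A x -> B (f x)) -> {within B, continuous g} ->
  {within A, continuous (fun x => g (f x))}.
Proof.
move=> cf AB /subspace_continuousP cg; apply/subspace_continuousP => x Ax W hW.
have /cf := cg _ (AB _ Ax) W hW.
by rewrite /within /= !nbhs_simpl /=; apply: filterS => y h /AB /h.
Qed.

(** * Parameters modulo 1 and intervals on the circle *)

Section SameParam.
Variable R : realType.
Implicit Types a b s t u v : R.

Lemma same_param_refl s : same_param s s.
Proof. by rewrite /same_param subrr rpred0. Qed.

Lemma same_param_sym s t : same_param s t -> same_param t s.
Proof. by rewrite /same_param -opprB rpredN. Qed.

Lemma same_param_trans s t u :
  same_param s t -> same_param t u -> same_param s u.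
Proof.
by move=> h1 h2; have := rpredD h1 h2; rewrite /same_param addrA subrK.
Qed.

Lemma same_param_int t (z : int) : same_param (t + z%:~R) t.
Proof. by rewrite /same_param addrAC subrr add0r; exact: intr_int. Qed.

Lemma same_paramP s t : same_param s t <-> exists z : int, s = t + z%:~R.
Proof.
split=> [/intrP[z hz]|[z ->]]; last exact: same_param_int.
by exists z; rewrite -hz addrC subrK.
Qed.

(* Two intervals [a, b] and [b, a + 1] cover the circle and meet only in their
   endpoints. *)
Lemma same_param_complement a b s t : a < b < a + 1 -> a <= t <= b ->
  b <= s <= a + 1 -> same_param s t -> t = a \/ t = b.
Proof.
move=> ab at_ as_ /same_paramP[z hz].
have : -1 < z <= 1.
  by rewrite -(ltr_int R) -(ler_int R) mulrNz; move: ab at_ as_; lra.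
move=> zb; have [z0|z1] : z = 0 \/ z = 1 by move: zb; clear; lia.
- by right; move: hz ab at_ as_; rewrite z0 addr0; lra.
- by left; move: hz ab at_ as_; rewrite z1; lra.
Qed.

(* The window [b - 1, a + 1] is longer than a period, so that it contains an
   open neighbourhood of some representative of every parameter. *)
Lemma window_shift a b s : a < b < a + 1 ->
  exists z : int, b - 1 < s + z%:~R < a + 1.
Proof.
move=> ab; set m := (a + b - 1) / 2.
exists (- Num.floor (s - m)).
have h1 := floor_le (s - m).
have := floorD1_gt (s - m).
rewrite mulrNz intrD; move: h1 ab; rewrite /m; lra.
Qed.

Lemma same_param_window a b s t : a < b < a + 1 -> a <= t <= b ->
  b - 1 < s < a + 1 -> same_param s t -> s = t.
Proof.
move=> ab at_ as_ /same_paramP[z hz].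
suff /eqP z0 : z == 0 by rewrite hz z0 addr0.
have : -1 < z < 1.
  by rewrite -!(ltr_int R) mulrNz; move: ab at_ as_; lra.
by clear; lia.
Qed.

(** A continuous injective function on a segment is monotone, so the arc is traced by an interval of
    parameters, possibly backwards. The bounds [a < b < a + 1] are those that [detour_move] asks
    for. *)
Lemma arc_interval (t : R -> R) u1 u2 :
  u1 < u2 -> {within `[u1, u2], continuous t} ->
  (forall u v, u1 <= u <= u2 -> u1 <= v <= u2 ->
     same_param (t u) (t v) -> u = v) ->
  exists a b, [/\ a < b < a + 1,
    forall s, a <= s <= b <-> exists u, u1 <= u <= u2 /\ s = t u
    & (a = t u1 /\ b = t u2) \/ (a = t u2 /\ b = t u1)].
Proof.
move=> u12 ct inj.
have m1 : u1 \in `[u1, u2] by rewrite in_itv /= lexx ltW.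
have m2 : u2 \in `[u1, u2] by rewrite in_itv /= lexx ltW.
have injt : {in `[u1, u2] &, injective t}.
  move=> x y; rewrite !in_itv /= => hx hy e; apply: inj => //.
  by rewrite e; exact: same_param_refl.
(* An interval of length at least 1 would contain [a + 1], which is the same point of the circle as
   the end [a], against injectivity. *)
have main a b : a < b -> (forall s, a <= s <= b ->
      exists u, u1 <= u <= u2 /\ s = t u) -> a = t u1 \/ a = t u2 ->
    a < b < a + 1.
  move=> ab sur ha; rewrite ab ltNge /=; apply/negP => ba.
  have [u [hu e]] : exists u, u1 <= u <= u2 /\ a + 1 = t u by apply: sur; lra.
  have sp : same_param (t u) a by rewrite -e; exact: (same_param_int a 1).
  move: m1 m2; rewrite !in_itv /= => m1 m2.
  have : t u = a.
    by case: ha sp => -> sp; rewrite (inj u _ hu _ sp).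
  by rewrite -e; lra.
have [le12|le21] := leP (t u1) (t u2).
- exists (t u1), (t u2).
  have mono := segment_continuous_inj_le le12 ct injt.
  have lt12 : t u1 < t u2.
    by rewrite lt_neqAle le12 andbT; apply/eqP => /injt e; move: u12;
      rewrite e ?ltxx.
  have im s : t u1 <= s <= t u2 <-> exists u, u1 <= u <= u2 /\ s = t u.
    split=> [hs|[u [hu ->]]].
      have [|c] := @IVT _ t u1 u2 s (ltW u12) ct.
        by rewrite min_l // max_r.
      by rewrite in_itv /= => hc <-; exists c.
    by rewrite !mono ?in_itv.
  split=> //; last by left.
  by apply: main => // [s /im|]; [|left].
- exists (t u2), (t u1).
  have mono := segment_continuous_inj_ge (ltW le21) ct injt.
  have im s : t u2 <= s <= t u1 <-> exists u, u1 <= u <= u2 /\ s = t u.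
    split=> [hs|[u [hu ->]]].
      have [|c] := @IVT _ t u1 u2 s (ltW u12) ct.
        by rewrite min_r ?max_l // ltW.
      by rewrite in_itv /= => hc <-; exists c.
    by rewrite !mono ?in_itv //= andbC.
  split=> //; last by right.
  by apply: main => // [s /im|]; [|right].
Qed.

End SameParam.

(** * Homeomorphisms of the plane, and charts inside charts *)

Section Charts.
Variable R : realType.
Local Notation plane := (R * R)%type.
Implicit Types (phi psi : plane -> plane) (s t u v : R) (p q : plane).

Lemma homeo_comp phi psi : homeo phi -> homeo psi -> homeo (phi \o psi).
Proof.
move=> [cp [p' [cp' pK p'K]]] [cq [q' [cq' qK q'K]]]; split.
  exact: continuous_after.
exists (q' \o p'); split; first exact: continuous_after.
- by move=> x /=; rewrite pK qK.
- by move=> x /=; rewrite q'K p'K.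
Qed.

Lemma homeo_id : homeo (fun p : plane => p).
Proof. by split; [|exists (fun p => p); split=> //]; exact: continuous_id. Qed.

Lemma homeo_inj phi : homeo phi -> injective phi.
Proof. by move=> [_ [g [_ phiK _]]]; exact: can_inj phiK. Qed.

Lemma homeo_affine (a b c d e f : R) : a * d - b * c != 0 ->
  homeo (fun p => (e + (a * p.1 + b * p.2), f + (c * p.1 + d * p.2))).
Proof.
move=> D0; split; first by continuity.
exists (fun q => ((a * d - b * c)^-1 * (d * (q.1 - e) - b * (q.2 - f)),
                  (a * d - b * c)^-1 * (a * (q.2 - f) - c * (q.1 - e)))).
split; first by continuity.
- by move=> [x y] /=; congr pair; field.
- by move=> [x y] /=; congr pair; field.
Qed.

Lemma homeo_image_closed phi (A : set plane) :
  homeo phi -> closed A -> closed (phi @` A).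
Proof.
move=> [_ [g [cg phiK gK]]] cA.
rewrite (_ : phi @` A = g @^-1` A);
  first exact: (continuous_closedP g).1 cg _ cA.
apply/seteqP; split=> [_ [p Ap <-]|q Aq] /=; first by rewrite phiK.
by exists (g q).
Qed.

Lemma squareP p : @square R p <-> `|p.1| <= 1 /\ `|p.2| <= 1.
Proof. by rewrite /square /= !ler_norml. Qed.

Lemma square_closed : closed (@square R).
Proof.
rewrite (_ : @square R = (fun p : plane =>
  Num.max `|p.1| `|p.2|) @^-1` [set x | x <= 1]).
  apply: (continuous_closedP _).1; last exact: closed_le.
  by continuity.
by apply/seteqP; split=> p; rewrite squareP /= ge_max => /andP.
Qed.

Lemma ord2P (i : 'I_2) : i = ord0 \/ i = ord_max.
Proof. by case: i => [[|[|//]] h]; [left|right]; apply: val_inj. Qed.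

Definition near_arcs (k : nat) (tau : 'I_k -> R -> R) s :=
  exists i u, u \in `[- 1, 1] /\ same_param s (tau i u).

Lemma near_arcs_param (k : nat) (tau : 'I_k -> R -> R) s t :
  same_param s t -> near_arcs tau s -> near_arcs tau t.
Proof.
move=> st [i [u [hu h]]]; exists i, u; split=> //.
exact: same_param_trans (same_param_sym st) h.
Qed.

Lemma periodic_same_param (c : R -> plane) s t : (forall t, c (t + 1) = c t) ->
  same_param s t -> c s = c t.
Proof.
move=> per.
have pern (n : nat) x : c (x + n%:R) = c x.
  by elim: n => [|n IH]; rewrite ?addr0// -natr1 addrA per.
move=> /same_paramP[[] n ->]; first exact: pern.
by rewrite NegzE mulrNz -pmulrn -[LHS](pern n.+1) subrK.
Qed.

(* The disc [psi @` square] inside [square], in which the picture T looks like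
   T2, the arc i of T2 being the part [a + b u], -1 <= u <= 1, of the arc
   [pi i] of T. *)
Definition subpicture (k : nat) (T T2 : picture R k) psi (pi : 'I_k -> 'I_k)
    (a b : R) : Prop :=
  [/\ homeo psi, forall p, @square R p -> @square R (psi p),
      injective pi /\ b != 0,
      forall i u, u \in `[- 1, 1] -> a + b * u \in `[- 1, 1] /\
        tnth T (pi i) (a + b * u) = psi (tnth T2 i u)
    & forall i u, u \in `[- 1, 1] -> (psi @` @square R) (tnth T i u) ->
        exists j v, [/\ v \in `[- 1, 1], i = pi j & u = a + b * v]].

(** All smaller discs needed later are cut out of a given one in this way. A point of the curve in
    the small disc lies in the large one, hence on an arc of [T]; as [phi] is injective, the last
    clause of [subpicture] applies to it. *)
Lemma looks_like_sub (c : R -> plane) (k : nat) (T T2 : picture R k) phi tau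
    psi pi (a b : R) :
  (forall t, c (t + 1) = c t) -> looks_like c T phi tau -> subpicture T T2 psi
    pi a b ->
  looks_like c T2 (phi \o psi) (fun i u => tau (pi i) (a + b * u)).
Proof.
move=> per [hphi ctau eqc inj out] [hpsi sub [injpi b0] eqT inT].
split.
- exact: homeo_comp.
- move=> i; apply: (@within_continuous_after _ _ _ _ _ (fun u =>
    a + b * u) _ _ _ (ctau (pi i))).
    by continuity.
  by move=> u /= hu; case: (eqT i u hu).
- by move=> i u hu /=; have [h1 h2] := eqT i u hu; rewrite eqc // h2.
- move=> i j u v hu hv; have [h1 _] := eqT i u hu; have [h2 _] := eqT j v hv.
  move=> /(inj _ _ _ _ h1 h2)[/injpi ij e]; split=> //.
  by apply: (mulfI b0); move: e; lra.
- move=> s [p sp hp]; have : (phi @` @square R) (c s).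
    by exists (psi p) => //; exact: sub.
  move=> /out[i [u [hu su]]].
  have [|j [v [hv ij uv]]] := inT i u hu.
    exists p => //; apply: (homeo_inj hphi).
    rewrite -eqc // [LHS]hp; exact: periodic_same_param.
  by exists j, v; split=> //; rewrite -ij -uv.
Qed.

End Charts.

(** * Pictures consisting of two graphs over [-1, 1] *)

Section Pictures.
Variable R : realType.
Local Notation plane := (R * R)%type.
Implicit Types (f : 'I_2 -> R -> R) (u v x y : R) (p q : plane).

Definition graphs f : picture R 2 := [tuple fun u => (u, f i u) | i < 2].

Lemma tnth_graphs f i u : tnth (graphs f) i u = (u, f i u).
Proof. by rewrite tnth_mktuple. Qed.

Definition pair_fun (g h : R -> R) (i : 'I_2) : R -> R :=
  if i == ord0 then g else h.

Definition mirror (g : R -> R) : 'I_2 -> R -> R :=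
  pair_fun g (fun x => - g x).

(** The chart of a crossing may list its two strands in either order; this exchanges them. *)
Lemma subpicture_swap :
  subpicture (crossing_picture R) (crossing_picture R)
    (fun p => (p.2, p.1)) (@rev_ord 2) 0 1.
Proof.
split.
- split; first by continuity.
  by exists (fun p => (p.2, p.1)); split; [continuity|case|case].
- by move=> p [].
- by split; [exact: rev_ord_inj|exact: oner_neq0].
- by move=> i u hu; rewrite add0r mul1r; split=> //; case: (ord2P i) => ->.
- move=> i u hu _; exists (rev_ord i), u.
  by rewrite rev_ordK add0r mul1r.
Qed.

(** Used to shrink the chart of a crossing until it avoids a given closed disc. *)
Lemma subpicture_scale (e : R) : 0 < e <= 1 ->
  subpicture (crossing_picture R) (crossing_picture R)
    (fun p => (0 + (e * p.1 + 0 * p.2), 0 + (0 * p.1 + e * p.2))) id 0 e.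
Proof.
move=> /andP[e0 e1]; split.
- by apply: homeo_affine; rewrite mul0r subr0 mulf_neq0 ?gt_eqF.
- by case=> x y; rewrite /square /= => -[]; nra.
- by split=> //; rewrite gt_eqF.
- move=> i u; rewrite in_itv /= => hu; rewrite in_itv /= add0r; split;
    first by nra.
  by case: (ord2P i) => -> /=; congr pair; ring.
- move=> i u hu [[x y] /= [/= hx hy]].
  case: (ord2P i) => -> /= [e1' e2'].
  + by exists ord0, x; split=> //; move: e1'; lra.
  + by exists ord_max, y; split=> //; move: e2'; lra.
Qed.

(** Near [z] the graphs are two lines of different slopes, so that an affine map with columns
    proportional to (1, m0) and (1, m1) carries the axes to them. *)
Lemma graphs_crossing f (z y0 d : R) (m : 'I_2 -> R) :
  -1 < z < 1 -> -1 < y0 < 1 -> 0 < d -> m ord0 != m ord_max ->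
  (forall i x, `|x - z| <= d -> f i x = y0 + m i * (x - z)) ->
  exists psi e, psi (0, 0) = (z, y0) /\
    subpicture (graphs f) (crossing_picture R) psi id z e.
Proof.
move=> hz hy d0 m01 hf.
set m0 := m ord0 in m01 *; set m1 := m ord_max in m01 *.
set M := 1 + `|m0| + `|m1|.
have M0 : 0 < M by rewrite /M; have := normr_ge0 m0; have := normr_ge0 m1; lra.
(* The three bounds keep the disc in the strip where the graphs are straight, and its first and
   second coordinates in [-1, 1]. *)
pose e := Num.min (d / 2) (Num.min ((1 - `|z|) / 2) ((1 - `|y0|) / M)).
have e0 : 0 < e.
  rewrite !lt_min !divr_gt0 //= ?subr_gt0 ?ltr_norml //; lra.
have ed : e * 2 <= d by rewrite -ler_pdivlMr // ge_min lexx.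
have ez : e * 2 <= 1 - `|z| by rewrite -ler_pdivlMr // !ge_min lexx orbT.
have ey : e * M <= 1 - `|y0| by rewrite -ler_pdivlMr // !ge_min lexx !orbT.
have strip x y : -1 <= x <= 1 -> -1 <= y <= 1 ->
    `|z + (e * x + e * y) - z| <= d.
  by move=> hx hy'; rewrite ler_norml; nra.
exists (fun p => (z + (e * p.1 + e * p.2),
  y0 + (e * m0 * p.1 + e * m1 * p.2))), e.
split; first by congr pair => /=; ring.
split.
- apply: homeo_affine.
  rewrite (_ : _ - _ = e * e * (m1 - m0)); last by ring.
  by rewrite !mulf_eq0 subr_eq0 [m1 == _]eq_sym (negbTE m01) orbF orbb gt_eqF.
- case=> x y; rewrite /square /= => -[hx hy']; split.
    by move: ez; case: (ger0P z) => z0 ez; nra.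
  have h (a b : R) : -1 <= b <= 1 -> - `|a| <= a * b <= `|a|.
    by move=> hb; case: (ger0P a) => ha; nra.
  have := h m0 x hx; have := h m1 y hy'.
  move: ey; rewrite /M; case: (ger0P y0) => y00 ey h1 h2; nra.
- by split=> //; rewrite gt_eqF.
- move=> i u; rewrite in_itv /= => hu; rewrite in_itv /=; split.
    by move: ez; case: (ger0P z) => z0 ez; nra.
  rewrite tnth_graphs hf; last first.
    by rewrite addrAC subrr add0r ler_norml; nra.
  by case: (ord2P i) => -> /=; congr pair; rewrite -/m0 -/m1; ring.
- move=> i u hu [[x y] [/= hx hy'] /=]; rewrite tnth_graphs => -[xu].
  have hux : `|u - z| <= d by rewrite -xu; exact: strip.
  rewrite hf // -xu => E.
  have : m1 - m0 != 0 by rewrite subr_eq0 eq_sym.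
  case: (ord2P i) E => -> E mn.
  + exists ord0, x; split=> //.
    suff -> : y = 0 by ring.
    apply/eqP; have : e * (m1 - m0) * y == 0 by apply/eqP; move: E;
      rewrite -/m0; lra.
    by rewrite !mulf_eq0 (negbTE mn) gt_eqF.
  + exists ord_max, y; split=> //.
    suff -> : x = 0 by ring.
    apply/eqP; have : e * (m1 - m0) * x == 0 by apply/eqP; move: E;
      rewrite -/m1; lra.
    by rewrite !mulf_eq0 (negbTE mn) gt_eqF.
Qed.

(** The disc is the part of the square over an interval; [r = - 1] turns it upside down. *)
Lemma graphs_strip f f' (T2 : picture R 2) (a b r : R) : b != 0 -> `|r| = 1 ->
  (forall u, u \in `[- 1, 1] -> a + b * u \in `[- 1, 1]) ->
  (forall i u, tnth T2 i u = (u, f' i u)) ->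
  (forall i u, u \in `[- 1, 1] -> f i (a + b * u) = r * f' i u) ->
  subpicture (graphs f) T2
    (fun p => (a + (b * p.1 + 0 * p.2), 0 + (0 * p.1 + r * p.2))) id a b.
Proof.
move=> b0 r1 hab hT2 hf; split.
- apply: homeo_affine; rewrite mul0r subr0 mulf_neq0 //.
  by rewrite -normr_eq0 r1 oner_eq0.
- case=> x y [/= hx hy]; split=> /=.
    by have := hab x; rewrite !in_itv /= mul0r addr0; exact.
  move: r1; case: (ger0P r) => _; nra.
- by split.
- move=> i u hu; split; first exact: hab.
  rewrite tnth_graphs hT2 hf //=.
  by congr pair; ring.
- move=> i u hu [[x y] [/= hx hy]]; rewrite tnth_graphs => -[xu _].
  by exists i, x; split=> //; rewrite -xu; ring.
Qed.

(* The mirror pairs of graphs of these functions cross at -2/3, at 2/3, and at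
   -2/3, 0, 2/3 respectively, and agree outside the R2 discs |x - 1/3| <= 2/3
   (first and third) and |x + 1/3| <= 2/3 (second and third). *)
Definition zig_left x := Num.min (1 / 2) (1 + 3 / 2 * x).
Definition zig_right x := Num.max (- (1 / 2)) (3 / 2 * x - 1).
Definition zigzag x :=
  Num.max (Num.min (1 + 3 / 2 * x) (- (3 / 2 * x))) (3 / 2 * x - 1).

(* A detour of the graph of [zigzag] straight to that of [zig_right] would make
   it touch the graph of [- zigzag] at -1/3; this one passes below. *)
Definition low_right x :=
  Num.max (3 / 8 * `|x + 1 / 3| - 3 / 4) (3 / 2 * x - 1).

End Pictures.

Ltac piecewise := rewrite ?/mirror ?/pair_fun /=;
  rewrite ?/zig_left ?/zig_right ?/zigzag ?/low_right;
  repeat match goal with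
  | |- context [Num.min ?a ?b] => case: (leP a b)
  | |- context [Num.max ?a ?b] => case: (leP a b)
  | |- context [`|?a|] => case: (ger0P a)
  end.

(** * The piecewise linear pictures of the bigons *)

Section ZigPictures.
Variable R : realType.
Local Notation plane := (R * R)%type.
Implicit Types (f : 'I_2 -> R -> R) (u v x y : R) (p q : plane).

Lemma subpicture_zig_left : exists psi,
  psi (- (2 / 3), 0) = (0, 0) /\
  subpicture (crossing_picture R) (graphs (mirror (@zig_left R)))
    psi id (1 / 4) (3 / 8).
Proof.
pose h x := Num.max 1 (2 + 3 * x) : R.
have h0 x : h x != 0 by rewrite gt_eqF // lt_max ltr01.
have hE x : zig_left x * h x = 1 + 3 / 2 * x.
  rewrite /h /zig_left; case: (leP x (- (1 / 3))) => hx.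
    by rewrite min_r ?max_l ?mulr1 //; lra.
  by rewrite min_l ?max_r //; lra.
exists (fun p => ((1 + 3 / 2 * p.1 + p.2 * h p.1) / 8,
                  (1 + 3 / 2 * p.1 - p.2 * h p.1) / 8)).
split; first by rewrite /= mul0r; congr pair; field.
split.
- have ch : continuous h by rewrite /h; continuity.
  have ch1 (g : plane -> R) : continuous g -> continuous (fun p => h (g p)).
    by move=> cg; exact: continuous_after.
  split; first by continuity; exact: ch1 (@continuous_fst _ _).
  exists (fun q => ((4 * (q.1 + q.2) - 1) * (2 / 3),
                    4 * (q.1 - q.2) * (h ((4 * (q.1 + q.2) - 1)
                      * (2 / 3)))^-1)).
  split.
  + continuity; apply: continuous_inv => [x|]; first exact: h0.
    by apply: ch1; continuity.
  + move=> [x y] /=.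
    rewrite (_ : (4 * _ - 1) * (2 / 3) = x); last by field.
    by congr pair; field; exact: h0.
  + move=> [x y] /=; set w := _ * (2 / 3); have := h0 w.
    rewrite (_ : 3 / 2 * w = 4 * (x + y) - 1); last by rewrite /w; field.
    by move=> hw; congr pair; field.
- case=> x y; rewrite /square /= => -[hx hy].
  have : 1 <= h x <= 5 by rewrite /h; case: (leP 1 (2 + 3 * x)); lra.
  by move=> hh; split; nra.
- by split=> //; lra.
- move=> i u; rewrite in_itv /= => hu; rewrite in_itv /=; split; first by lra.
  rewrite tnth_graphs /mirror /pair_fun; case: (ord2P i) => -> /=.
    by rewrite hE; congr pair; field.
  by rewrite mulNr hE; congr pair; field.
- move=> i u hu [[x y] [/= hx hy]].
  by case: (ord2P i) => -> /= [E1 E2];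
    [exists ord0, x|exists ord_max, x]; split=> //; move: E1 E2; lra.
Qed.

Lemma subpicture_left_R2 : subpicture (graphs (mirror (@zig_left R)))
  (R2_left R)
  (fun p => (1 / 3 + (2 / 3 * p.1 + 0 * p.2), 0 + (0 * p.1 + 1 * p.2))) id
  (1 / 3) (2 / 3).
Proof.
apply: (@graphs_strip _ _ (fun i _ => if i == ord0 then 2^-1 else - 2^-1)).
- by apply/eqP; lra.
- by rewrite normr1.
- by move=> u; rewrite !in_itv /=; lra.
- by move=> i u; case: (ord2P i) => ->.
- move=> i u; rewrite in_itv /= => hu; case: (ord2P i) => ->; piecewise; lra.
Qed.

Lemma subpicture_zigzag_R2 : subpicture (graphs (mirror (@zigzag R)))
  (R2_right R)
  (fun p => (1 / 3 + (2 / 3 * p.1 + 0 * p.2), 0 + (0 * p.1 + 1 * p.2))) id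
  (1 / 3) (2 / 3).
Proof.
apply: (@graphs_strip _ _
  (fun i u => if i == ord0 then `|u| - 2^-1 else 2^-1 - `|u|)).
- by apply/eqP; lra.
- by rewrite normr1.
- by move=> u; rewrite !in_itv /=; lra.
- by move=> i u; case: (ord2P i) => ->.
- move=> i u; rewrite in_itv /= => hu; case: (ord2P i) => ->; piecewise; lra.
Qed.

(** Over this interval arc 0 is the lower one, hence the flip. *)
Lemma subpicture_right_R2 : subpicture (graphs (mirror (@zig_right R)))
  (R2_left R)
  (fun p => (- (1 / 3) + (2 / 3 * p.1 + 0 * p.2), 0 + (0 * p.1 + - 1 * p.2))) id
  (- (1 / 3)) (2 / 3).
Proof.
apply: (@graphs_strip _ _ (fun i _ => if i == ord0 then 2^-1 else - 2^-1)).
- by apply/eqP; lra.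
- by rewrite normrN1.
- by move=> u; rewrite !in_itv /=; lra.
- by move=> i u; case: (ord2P i) => ->.
- move=> i u; rewrite in_itv /= => hu; case: (ord2P i) => ->; piecewise; lra.
Qed.

Lemma subpicture_zigzag_R2_flip : subpicture (graphs (mirror (@zigzag R)))
  (R2_right R)
  (fun p => (- (1 / 3) + (2 / 3 * p.1 + 0 * p.2), 0 + (0 * p.1 + - 1 * p.2))) id
  (- (1 / 3)) (2 / 3).
Proof.
apply: (@graphs_strip _ _
  (fun i u => if i == ord0 then `|u| - 2^-1 else 2^-1 - `|u|)).
- by apply/eqP; lra.
- by rewrite normrN1.
- by move=> u; rewrite !in_itv /=; lra.
- by move=> i u; case: (ord2P i) => ->.
- move=> i u; rewrite in_itv /= => hu; case: (ord2P i) => ->; piecewise; lra.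
Qed.

(* The conditions on a pair of graphs under which redrawing a crossing as this
   pair yields again a generic curve. *)
Definition tame_graphs f : Prop :=
  [/\ forall i, continuous (f i),
      forall i u, -1 <= u <= 1 -> -1 < f i u < 1
    & forall z, -1 <= z <= 1 -> f ord0 z = f ord_max z ->
        [/\ -1 < z < 1, z \in [:: - (2 / 3); 0; 2 / 3]
          & exists d m, [/\ 0 < d, m ord0 != m ord_max
              & forall i x, `|x - z| <= d ->
                  f i x = f ord0 z + m i * (x - z)]]].

Lemma tame_zigzag : tame_graphs (mirror (@zigzag R)).
Proof.
split.
- move=> i; case: (ord2P i) => ->; rewrite /mirror /pair_fun /= /zigzag;
    continuity.
- move=> i u hu; case: (ord2P i) => ->; piecewise; lra.
- move=> z hz E.
  have Z : [\/ z = - (2 / 3), z = 0 | z = 2 / 3].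
    move: E; have [h1|h1] := leP z (- (1 / 3)).
      by move=> E; constructor 1; move: E; piecewise; lra.
    have [h2|h2] := leP z (1 / 3).
      by move=> E; constructor 2; move: E; piecewise; lra.
    by move=> E; constructor 3; move: E; piecewise; lra.
  split; first by case: Z => ->; lra.
    by rewrite !inE; case: Z => ->; rewrite eqxx ?orbT.
  (* [zigzag] falls at 0 and rises at the two other zeros. It breaks only at -1/3 and 1/3, so that
     it is straight within 1/6 of each zero. *)
  pose m := (if z == 0 then - (3 / 2) else 3 / 2) : R.
  exists (1 / 6), (fun i => if i == ord0 then m else - m).
  split=> /=; first by lra.
    by rewrite /m; case: ifP => _; apply/eqP; lra.
  move=> i x; rewrite ler_norml.
  have -> : mirror (@zigzag R) ord0 z = 0.
    by case: Z => ->; piecewise; lra.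
  case: Z => Z0.
  + have -> : m = 3 / 2 by rewrite /m Z0 ifF //; apply/eqP; lra.
    by rewrite Z0 => hx; case: (ord2P i) => ->; piecewise; lra.
  + have -> : m = - (3 / 2) by rewrite /m Z0 eqxx.
    by rewrite Z0 => hx; case: (ord2P i) => ->; piecewise; lra.
  + have -> : m = 3 / 2 by rewrite /m Z0 ifF //; apply/eqP; lra.
    by rewrite Z0 => hx; case: (ord2P i) => ->; piecewise; lra.
Qed.

(** Covers the three pairs, met on the way from [zigzag] to [zig_right], whose bigons are gone. *)
Lemma tame_single (f : 'I_2 -> R -> R) :
  (forall i, continuous (f i)) ->
  (forall i u, -1 <= u <= 1 -> -1 < f i u < 1) ->
  (forall u, -1 <= u <= 1 -> f ord0 u = f ord_max u -> u = 2 / 3) ->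
  (forall u, `|u - 2 / 3| <= 1 / 6 ->
    f ord0 u = 3 / 2 * u - 1 /\ f ord_max u = - (3 / 2 * u - 1)) ->
  tame_graphs f.
Proof.
move=> cf bf zf lf; split=> // z hz /(zf _ hz) ->; split.
- lra.
- by rewrite !inE eqxx !orbT.
exists (1 / 6), (fun i => if i == ord0 then 3 / 2 else - (3 / 2)).
split=> /=; [lra|by apply/eqP; lra|].
have [|-> _] := lf (2 / 3); first by rewrite subrr normr0; lra.
by move=> i x /lf[h0 h1]; case: (ord2P i) => -> /=; rewrite ?h0 ?h1; lra.
Qed.

Lemma tame_low : tame_graphs (pair_fun (@low_right R) (fun x => - zigzag x)).
Proof.
apply: tame_single.
- move=> i; case: (ord2P i) => ->; rewrite /pair_fun /= /zigzag /low_right;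
    continuity.
- move=> i u hu; case: (ord2P i) => ->; piecewise; lra.
- by move=> u hu; piecewise; lra.
- move=> u; rewrite ler_norml => hu; split; piecewise; lra.
Qed.

Lemma tame_low_right :
  tame_graphs (pair_fun (@low_right R) (fun x => - zig_right x)).
Proof.
apply: tame_single.
- move=> i; case: (ord2P i) => ->; rewrite /pair_fun /= /zig_right /low_right;
    continuity.
- move=> i u hu; case: (ord2P i) => ->; piecewise; lra.
- by move=> u hu; piecewise; lra.
- move=> u; rewrite ler_norml => hu; split; piecewise; lra.
Qed.

Lemma tame_right : tame_graphs (mirror (@zig_right R)).
Proof.
apply: tame_single.
- move=> i; case: (ord2P i) => ->; rewrite /mirror /pair_fun /= /zig_right;
    continuity.
- move=> i u hu; case: (ord2P i) => ->; piecewise; lra.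
- by move=> u hu; piecewise; lra.
- move=> u; rewrite ler_norml => hu; split; piecewise; lra.
Qed.

End ZigPictures.

(** * Redrawing a curve inside a disc *)

Section Redraw.
Variables (R : realType) (c : R -> R * R) (phi : R * R -> R * R).
Variables (tau : 'I_2 -> R -> R) (f0 : 'I_2 -> R -> R).
Hypothesis c_generic : generic_closed_curve c.
Hypothesis c_chart : looks_like c (graphs f0) phi tau.
Hypothesis f0_continuous : forall i, continuous (f0 i).
Hypothesis f0_bound : forall i u, -1 <= u <= 1 -> -1 < f0 i u < 1.
Implicit Types (s t u v : R) (f : 'I_2 -> R -> R).
Local Notation plane := (R * R)%type.

Let c_per : forall t, c (t + 1) = c t.
Proof. by case: c_generic. Qed.

Lemma chart_arc i s u : u \in `[- 1, 1] -> same_param s (tau i u) ->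
  c s = phi (u, f0 i u).
Proof.
move=> hu h; case: c_chart => _ _ eqc _ _.
by rewrite (periodic_same_param c_per h) eqc // tnth_graphs.
Qed.

Lemma chart_param_inj i j s u v : u \in `[- 1, 1] -> v \in `[- 1, 1] ->
  same_param s (tau i u) -> same_param s (tau j v) -> i = j /\ u = v.
Proof.
move=> hu hv h1 h2; case: c_chart => _ _ _ inj _.
exact: inj (same_param_trans (same_param_sym h1) h2).
Qed.

Lemma chart_far s : ~ near_arcs tau s -> ~ (phi @` @square R) (c s).
Proof. by case: c_chart => _ _ _ _ out h /out. Qed.

(** The set has at most one point because no parameter lies on the arcs in two ways; the default
    value [c s] leaves the curve alone outside the disc. *)
Definition redraw f s : plane :=
  xget (c s) [set p | exists i u,
    [/\ u \in `[- 1, 1], same_param s (tau i u) & p = phi (u, f i u)]].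

Lemma redraw_near f i s u : u \in `[- 1, 1] -> same_param s (tau i u) ->
  redraw f s = phi (u, f i u).
Proof.
move=> hu h; rewrite /redraw; case: xgetP =>
  [p _ [j [v [hv hj ->]]]|/(_ (phi (u, f i u)))].
  by have [-> ->] := chart_param_inj hv hu hj h.
by case; exists i, u.
Qed.

Lemma redraw_far f s : ~ near_arcs tau s -> redraw f s = c s.
Proof. 
move=> n; rewrite /redraw xgetPN // => p [i [u [hu su _]]].
by apply: n; exists i, u.
Qed.

Lemma redraw_same f s : (forall i u, u \in `[- 1, 1] ->
  same_param s (tau i u) -> f i u = f0 i u) -> redraw f s = c s.
Proof.
move=> h; have [[i [u [hu su]]]|n] := pselect (near_arcs tau s).
  by rewrite (redraw_near f hu su) (h i u) // (chart_arc hu su).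
exact: redraw_far.
Qed.

Lemma redraw_periodic f t : redraw f (t + 1) = redraw f t.
Proof.
have h := same_param_int t 1; rewrite -[1%:~R]/(1 : R) in h.
have [[i [u [hu su]]]|n] := pselect (near_arcs tau t).
  by rewrite (redraw_near f hu su) (redraw_near f hu (same_param_trans h su)).
by rewrite !redraw_far // => /(near_arcs_param h).
Qed.

(** The bound keeps the new arcs in the disc, and the equal ends let them fit the rest of the
    curve. *)
Definition good_redrawing f : Prop :=
  [/\ forall i, continuous (f i),
      forall i u, -1 <= u <= 1 -> -1 < f i u < 1
    & forall i, f i (-1) = f0 i (-1) /\ f i 1 = f0 i 1].

(** In the coordinates of the chart, redrawing adds to the second coordinate the correction
    [f i - f0 i] along arc [i]. It vanishes at both ends of the arc, so that extending it by 0 is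
    continuous. *)
Lemma redraw_continuous f : good_redrawing f -> continuous (redraw f).
Proof.
move=> [cf _ ends].
have [hphi ctau _ _ _] := c_chart.
have [cphi [g [cg phiK gK]]] := hphi.
have [cc _ _ _] := c_generic.
have cq : continuous (fun s => (g (c s)).1).
  by apply: (continuous_after _ (@continuous_fst _ _)); exact: continuous_after.
pose arc i s := exists u, u \in `[- 1, 1] /\ same_param s (tau i u).
pose diff i t := f i (g (c t)).1 - f0 i (g (c t)).1.
pose corr i s := if pselect (arc i s) then diff i s else 0.
have corr_in i s : arc i s -> corr i s = diff i s.
  by rewrite /corr; case: pselect.
have corr_out i s : ~ arc i s -> corr i s = 0.
  by rewrite /corr; case: pselect.
have corr_param i s t : same_param s t -> corr i s = corr i t.
  move=> st; rewrite /corr /diff (periodic_same_param c_per st).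
  suff -> : arc i s = arc i t by [].
  apply/propext; split=> -[u [hu h]]; exists u; split=> //.
    exact: same_param_trans (same_param_sym st) h.
  exact: same_param_trans st h.
have cdiff i : continuous (diff i).
  have h1 : continuous (fun t => f i (g (c t)).1) by exact: continuous_after.
  have h2 : continuous (fun t => f0 i (g (c t)).1) by exact: continuous_after.
  rewrite /diff; exact: (continuous_add h1 (continuous_opp h2)).
have ccorr i : continuous (corr i).
  move=> s.
  have m11 : (-1 : R) < 1 by lra.
  have [|a [b [ab im ends_ab]]] := arc_interval m11 (ctau i).
    by move=> u v hu hv h; case: (chart_param_inj (i := i) (j :=
      i) hu hv (same_param_refl _) h).
  have [z hz] := window_shift s ab.
  (* [clip] retracts the line onto [a, b]. As [diff i] vanishes at both ends, [corr i] is [diff i]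
     after [clip] on a window that contains a neighbourhood of a translate of [s]. *)
  pose clip t := Num.max a (Num.min b t).
  have cE : continuous (fun t => diff i (clip (t + z%:~R))).
    apply: (@continuous_after _ _ _ (fun t => clip (t + z%:~R))) => //.
    by rewrite /clip; continuity.
  have diff_end t : t = tau i (-1) \/ t = tau i 1 -> diff i t = 0.
    have [e1 e2] := ends i.
    case=> ->; rewrite /diff (chart_arc _ (same_param_refl _))
      ?in_itv /= ?lexx ?ltW // phiK /=.
      by rewrite e1 subrr.
    by rewrite e2 subrr.
  have corrE t : b - 1 < t < a + 1 -> corr i t = diff i (clip t).
    move=> ht; rewrite /corr; case: pselect => [[u [hu h]]|n].
      have tu : a <= tau i u <= b by apply/im; exists u.
      have := same_param_window ab tu ht h => tE; rewrite -tE in tu.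
      by case/andP: tu => ta tb; rewrite /clip min_r // max_r.
    have nt : ~ (a <= t <= b).
      move=> /im[u [hu e]]; apply: n; exists u; split; first by rewrite in_itv.
      by rewrite e; exact: same_param_refl.
    rewrite [RHS]diff_end //.
    have [ta|ta] := ltP t a.
      have -> : clip t = a by rewrite /clip min_r ?max_l; lra.
      by case: ends_ab => -[ea _]; [left|right].
    have -> : clip t = b by rewrite /clip min_l ?max_r; lra.
    by case: ends_ab => -[_ eb]; [right|left].
  have near_s : \forall t \near s, corr i t = diff i (clip (t + z%:~R)).
    have : open [set t | b - 1 < t + z%:~R < a + 1].
      rewrite (_ : mkset _ = (fun t => t + z%:~R) @^-1` `]b - 1,
        a + 1[%classic).
        apply: open_comp; last exact: interval_open.
        have ct : continuous (fun t => t + z%:~R) by continuity.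
        by move=> t _; exact: ct.
      by apply/seteqP; split=> t /=; rewrite in_itv.
    move=> oW; have : nbhs s [set t | b - 1 < t + z%:~R < a + 1] by exact:
      open_nbhs_nbhs.
    apply: filterS => t /= ht.
    by rewrite -corrE //; apply: corr_param;
      exact: same_param_sym (same_param_int t z).
  rewrite /continuous_at (nbhs_singleton near_s).
  apply: cvg_trans (cE s).
  by apply: near_eq_cvg; near=> t; apply/esym; near: t.
(* At most one of the two corrections is nonzero, since no parameter lies on both arcs. *)
have cdraw : continuous (fun s => phi ((g (c s)).1,
  (g (c s)).2 + (corr ord0 s + corr ord_max s))).
  apply: continuous_after cphi; apply: continuous_pair => //.
  apply: continuous_add.
    by apply: (continuous_after _ (@continuous_snd _ _));
      exact: continuous_after.
  by apply: continuous_add.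
rewrite (_ : redraw f = fun s => phi ((g (c s)).1,
  (g (c s)).2 + (corr ord0 s + corr ord_max s))) //.
apply/funext => s.
have [[i [u [hu su]]]|n] := pselect (near_arcs tau s).
  have arci : arc i s by exists u.
  have arcN j : j != i -> ~ arc j s.
    move=> /eqP ji [v [hv sv]]; apply: ji.
    by case: (chart_param_inj hv hu sv su).
  have ci : corr i s = f i u - f0 i u.
    by rewrite corr_in // /diff (chart_arc hu su) phiK.
  have cj j : j != i -> corr j s = 0.
    by move=> /arcN; exact: corr_out.
  rewrite (redraw_near f hu su) (chart_arc hu su) phiK /=; congr (phi (_, _)).
  have [ei|ei] := ord2P i; rewrite ei in ci cj *; rewrite ci.
    by rewrite (cj ord_max) //; ring.
  by rewrite (cj ord0) //; ring.
have cj j : corr j s = 0.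
  by apply: corr_out => -[u [hu su]]; case: n; exists j, u.
by rewrite redraw_far // !cj !addr0 -surjective_pairing gK.
Unshelve. all: by end_near. Qed.

Lemma redraw_chart f : good_redrawing f ->
  looks_like (redraw f) (graphs f) phi tau.
Proof.
move=> gf; have [hphi ctau _ inj out] := c_chart; split=> //.
- by move=> i u hu; rewrite tnth_graphs (redraw_near f hu (same_param_refl _)).
- move=> s h; have [//|n] := pselect (near_arcs tau s).
  by apply: out; rewrite -(redraw_far f n).
Qed.

Lemma redraw_in_disc f s : good_redrawing f -> near_arcs tau s ->
  (phi @` @square R) (redraw f s).
Proof.
move=> [_ bf _] [i [u [hu su]]]; rewrite (redraw_near f hu su).
exists (u, f i u) => //; rewrite in_itv in hu; split=> //=.
by have := bf i u hu; lra.
Qed.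

(** A double point is either an old one outside the disc or an intersection of the two graphs. The
    latter have charts by [graphs_crossing]; the former keep a shrunken version of their old
    chart. *)
Lemma redraw_generic f : good_redrawing f -> tame_graphs f ->
  generic_closed_curve (redraw f).
Proof.
move=> gf tf; have ctr := redraw_chart gf.
have [hphi _ _ _ rout] := ctr.
have [_ _ cfin ccross] := c_generic.
have [_ bf tz] := tf.
have rper := redraw_periodic f.
have dbl s t : double_pair (redraw f) s t ->
    (~ near_arcs tau s /\ ~ near_arcs tau t /\ double_pair c s t) \/
    exists i z, [/\ -1 <= z <= 1, f ord0 z = f ord_max z
                  & same_param s (tau i z)].
  move=> [e n].
  have [ns|ns] := pselect (near_arcs tau s).
    right; have := redraw_in_disc gf ns; rewrite e => /rout[j [v [hv sv]]].
    case: ns => i [u [hu su]].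
    move: e; rewrite (redraw_near f hu su) (redraw_near f hv sv).
    move=> /(homeo_inj hphi)[uv]; rewrite -uv in sv * => e.
    exists i, u; split=> //.
    case: (ord2P i) (ord2P j) su e sv => -> [] -> // su e sv; case: n;
      exact: same_param_trans su (same_param_sym sv).
  left; split=> //.
  have nt : ~ near_arcs tau t.
    by move=> /(redraw_in_disc gf); rewrite -e redraw_far //; exact: chart_far.
  by split=> //; split=> //; rewrite -(redraw_far f ns) e redraw_far.
split.
- exact: redraw_continuous.
- exact: rper.
- apply: (@sub_finite_set _ _ ([set p | exists s t,
    double_pair c s t /\ p = c s] `|`
     [set phi (z, f ord0 z) | z in [set` [:: - (2 / 3); 0; 2 / 3]]])).
    move=> p [s [t [st ->]]]; have [[ns [_ h]]|[i [z [hz e sz]]]] := dbl _ _ st.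
      by left; exists s, t; split=> //; rewrite redraw_far.
    right; exists z; first by have [_ + _] := tz z hz e.
    rewrite (redraw_near f _ sz) //.
    by case: (ord2P i) => ->; rewrite ?e.
  by rewrite finite_setU; split=> //; apply: finite_image; exact: finite_seq.
- move=> s t st; have [[ns [_ h]]|[i [z [hz e sz]]]] := dbl _ _ st; last first.
    have [hz' _ [d [m [d0 m01 lin]]]] := tz z hz e.
    have [psi [eps [psi0 sub]]] := graphs_crossing hz' (bf ord0 z hz)
      d0 m01 lin.
    exists (phi \o psi), (fun i u => tau (id i) (z + eps * u)); split.
      exact: looks_like_sub ctr sub.
    rewrite (redraw_near f _ sz) //= psi0.
    by case: (ord2P i) => ->; rewrite ?e.
  have [phi1 [tau1 [ch1 e1]]] := ccross _ _ h.
  have [[cphi1 _] _ _ _ _] := ch1.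
  (* The old chart may overlap the redrawn disc, but its centre lies outside that closed set, so
     that a smaller copy of it avoids the disc. *)
  have oW : open (phi1 @^-1` (~` (phi @` @square R))).
    apply: open_comp; first by move=> *; exact: cphi1.
    apply: closed_openC; apply: homeo_image_closed => //; exact: square_closed.
  have : nbhs ((0, 0) : plane) (phi1 @^-1` (~` (phi @` @square R))).
    by apply: open_nbhs_nbhs; split=> //=; rewrite e1; exact: chart_far.
  move=> /nbhs_ballP[r /= r0 hr].
  pose eps := Num.min (r / 2) 1.
  have eps01 : 0 < eps <= 1 
    by rewrite /eps lt_min divr_gt0 //= ltr01 ge_min lexx orbT.
  have epsr : eps < r by rewrite /eps gt_min; apply/orP; left; lra.
  have sub := subpicture_scale eps01.
  have [hphi2 ctau2 eqc2 inj2 out2] := looks_like_sub c_per ch1 sub.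
  exists (phi1 \o (fun p => (0 + (eps * p.1 + 0 * p.2),
    0 + (0 * p.1 + eps * p.2)))),
    (fun i u => tau1 (id i) (0 + eps * u)).
  split; last by rewrite redraw_far // -e1 /=; congr phi1; congr pair; ring.
  have avoid p : square p -> ~ (phi @` @square R)
      (phi1 (0 + (eps * p.1 + 0 * p.2), 0 + (0 * p.1 + eps * p.2))).
    move=> [hx hy]; apply: hr; split; rewrite /ball /= ltr_norml; nra.
  split=> //.
  - move=> i u hu; rewrite redraw_far; first exact: eqc2.
    move=> ns'; apply: (avoid (tnth (crossing_picture R) i u)).
      by rewrite in_itv /= in hu; case: (ord2P i) => -> /=; split=> //=; lra.
    have := eqc2 i u hu; rewrite /= => <-.
    case: ns' => j [v [hv sv]]; rewrite (chart_arc hv sv).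
    exists (v, f0 j v) => //; rewrite in_itv in hv; split=> //=.
    by have := f0_bound j hv; lra.
  - move=> s' [p sp hp]; apply: out2; exists p => //.
    rewrite -(@redraw_far f) // => /(redraw_in_disc gf); rewrite -hp;
      exact: avoid.
Qed.

End Redraw.

(** * Redrawn diagrams and the moves between them *)

Lemma rev_ord0 : rev_ord ord0 = ord_max :> 'I_2.
Proof. exact: val_inj. Qed.

Lemma rev_ord_max : rev_ord ord_max = ord0 :> 'I_2.
Proof. exact: val_inj. Qed.

Lemma half_neq_opp (R : realType) : (2^-1 : R) <> - 2^-1.
Proof. lra. Qed.

Lemma R2_crossing (R : realType) (x : R) : x - 2^-1 = 2^-1 - x <-> x = 2^-1.
Proof. by split; lra. Qed.

Section RedrawnDiagrams.
Variables (R : realType) (c : R -> R * R) (phi : R * R -> R * R).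
Variables (tau : 'I_2 -> R -> R) (f0 : 'I_2 -> R -> R).
Hypothesis c_generic : generic_closed_curve c.
Hypothesis c_chart : looks_like c (graphs f0) phi tau.
Hypothesis f0_continuous : forall i, continuous (f0 i).
Hypothesis f0_bound : forall i u, -1 <= u <= 1 -> -1 < f0 i u < 1.
Implicit Types (s t u v : R) (f : 'I_2 -> R -> R) (W : R -> R -> Prop)
  (Q : 'I_2 -> R -> Prop) (D : diagram R).

(** The conditions that [diagram] imposes on [passes_over], for crossings away from the disc, where
    redrawing changes nothing. *)
Definition far_crossings W : Prop :=
  [/\ forall s t, W s t -> double_pair c s t,
      forall s t, W s t -> ~ W t s,
      forall s s' t t', same_param s s' -> same_param t t' -> W s t -> W s' t'
    & forall s t, W s t -> ~ near_arcs tau s /\ ~ near_arcs tau t].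

(* [Q i u] says that at u the graphs cross and the arc i is the upper one. *)
Definition near_crossings f Q : Prop :=
  forall i u, Q i u ->
    [/\ -1 <= u <= 1, f ord0 u = f ord_max u & ~ Q (rev_ord i) u].

Definition redrawn_over Q W s t : Prop :=
  W s t \/ exists i u,
    [/\ Q i u, same_param s (tau i u) & same_param t (tau (rev_ord i) u)].

(** A characterization instead of a construction, so that a diagram given beforehand can be
    recognized as a redrawing. *)
Definition is_redrawn f Q W D : Prop :=
  curve D = redraw c phi tau f /\
  forall s t, passes_over D s t <-> redrawn_over Q W s t.

Lemma redrawn_exists f Q W : good_redrawing f0 f -> tame_graphs f ->
  far_crossings W -> near_crossings f Q -> exists D, is_redrawn f Q W D.
Proof.
move=> gf tf [Wd Wa Wp Wf] nQ.
have rev_neq (i : 'I_2) : i <> rev_ord i by case: (ord2P i) => ->.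
have dbl s t : redrawn_over Q W s t -> double_pair (redraw c phi tau f) s t.
  case=> [w|[i [u [q su tu]]]].
    have [ns nt] := Wf _ _ w; have [e n] := Wd _ _ w.
    by split=> //; rewrite !redraw_far.
  have [hu e _] := nQ _ _ q; split.
    rewrite (redraw_near c_chart f (i := i) (u := u)) //.
    rewrite (redraw_near c_chart f (i := rev_ord i) (u := u)) //.
    by congr (phi (_, _)); case: (ord2P i) => ->;
      rewrite ?rev_ord0 ?rev_ord_max.
  move=> st; apply: (rev_neq i).
  by case: (chart_param_inj c_chart (u := u) (v := u) hu hu su
    (same_param_trans st tu)).
have asym s t : redrawn_over Q W s t -> ~ redrawn_over Q W t s.
  case=> [w|[i [u [q su tu]]]] [w'|[j [v [q' tv sv]]]].
  - exact: Wa w w'.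
  - have [_ nt] := Wf _ _ w; apply: nt; exists j, v.
    by have [? _ _] := nQ _ _ q'.
  - have [_ nt] := Wf _ _ w'; apply: nt; exists i, u.
    by have [? _ _] := nQ _ _ q.
  - have [hu _ nq] := nQ _ _ q; have [hv _ _] := nQ _ _ q'.
    have [e1 e2] := chart_param_inj c_chart (u := u) (v := v) hu hv tu tv.
    by apply: nq; rewrite e1 e2.
have par s s' t t' : same_param s s' -> same_param t t' ->
    redrawn_over Q W s t -> redrawn_over Q W s' t'.
  move=> ss tt [w|[i [u [q su tu]]]]; first by left; exact: Wp ss tt w.
  right; exists i, u; split=> //.
    exact: same_param_trans (same_param_sym ss) su.
  exact: same_param_trans (same_param_sym tt) tu.
by exists (Diagram (redraw_generic c_generic c_chart f0_continuous f0_bound gf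
  tf)
  dbl asym par).
Qed.

Lemma near_over Q W i j u v : far_crossings W ->
  (forall i u, Q i u -> -1 <= u <= 1) ->
  u \in `[- 1, 1] -> v \in `[- 1, 1] ->
  redrawn_over Q W (tau i u) (tau j v) <-> [/\ Q i u, j = rev_ord i & v = u].
Proof.
move=> [_ _ _ Wf] Qb hu hv; split=> [[w|[k [x [q su tv]]]]|[q -> ->]].
- have [n _] := Wf _ _ w; case: n; exists i, u; split=> //.
  exact: same_param_refl.
- have hx : x \in `[- 1, 1] by rewrite in_itv; exact: Qb q.
  have [ki xu] := chart_param_inj c_chart hu hx (same_param_refl _) su.
  have [kj xv] := chart_param_inj c_chart hv hx (same_param_refl _) tv.
  by rewrite ki xu xv; split.
- by right; exists i, u; split=> //; exact: same_param_refl.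
Qed.

(** The two redrawings agree off a smaller disc, in which they show the two sides of R2. Arc 0 must
    be on top there, by the convention of [picture_over]; the double points of [R2_right] are at |u|
    = 1/2. *)
Lemma redrawn_R2 f f' Q Q' W D D' psi (a b : R) :
  good_redrawing f0 f -> good_redrawing f0 f' ->
  far_crossings W -> near_crossings f Q -> near_crossings f' Q' ->
  is_redrawn f Q W D -> is_redrawn f' Q' W D' ->
  subpicture (graphs f) (R2_left R) psi id a b ->
  subpicture (graphs f') (R2_right R) psi id a b ->
  (forall i u, -1 <= u <= 1 -> (forall v, -1 <= v <= 1 -> u <> a + b * v) ->
     f' i u = f i u /\ (Q' i u <-> Q i u)) ->
  (forall i u, -1 <= u <= 1 -> ~ Q i (a + b * u)) ->
  (forall i u, -1 <= u <= 1 ->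
     (Q' i (a + b * u) <-> i = ord0 /\ `|u| = 2^-1)) ->
  local_move (R2_left R) (R2_right R) D D'.
Proof.
move=> gf gf' fW nQ nQ' [cD oD] [cD' oD'] sub sub' out inQ inQ'.
have Qb i u : Q i u -> -1 <= u <= 1 by move=> /nQ[].
have Qb' i u : Q' i u -> -1 <= u <= 1 by move=> /nQ'[].
have per f1 t : redraw c phi tau f1 (t + 1) = redraw c phi tau f1 t.
  exact: redraw_periodic c_generic c_chart f1 t.
have ch := looks_like_sub (per f) (redraw_chart c_chart gf) sub.
have ch' := looks_like_sub (per f') (redraw_chart c_chart gf') sub'.
have hab u : u \in `[- 1, 1] -> a + b * u \in `[- 1, 1].
  by case: sub => _ _ _ h _ hu; case: (h ord0 u hu).
have b0 : b != 0 by case: sub => _ _ [].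
exists (phi \o psi), (fun i u => tau i (a + b * u)); split.
- split; first by rewrite cD.
  move=> i j u v hu hv; rewrite oD near_over ?hab //; split=> [[q _ _]|].
    by case: (inQ i u); rewrite in_itv in hu.
  case; case: (ord2P i) (ord2P j) =>
    -> [] -> /= /pair_equal_spec[uv e] [lt_ij|[_ lt_uv]] //.
  + by move: lt_uv; rewrite uv ltxx.
  + by case: (@half_neq_opp R).
  + by move: lt_uv; rewrite uv ltxx.
- split; first by rewrite cD'.
  move=> i j u v hu hv; rewrite oD' near_over ?hab //.
  have hu' : -1 <= u <= 1 by rewrite in_itv in hu.
  split=> [[/(inQ' _ _ hu')[-> u2] -> e]|].
    have -> : v = u by exact: (mulfI b0 (addrI _ e)).
    by split; [rewrite /=; congr pair; exact/R2_crossing|left].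
  case; case: (ord2P i) (ord2P j) =>
    -> [] -> /= /pair_equal_spec[uv e] [lt_ij|[_ lt_uv]] //.
  + by move: lt_uv; rewrite uv ltxx.
  + rewrite -uv in e *; split; [|by rewrite rev_ord0|by []].
    by apply/(inQ' _ _ hu'); split=> //; exact/R2_crossing.
  + by move: lt_uv; rewrite uv ltxx.
- have away s i u : ~ (exists i u, u \in `[- 1, 1] /\
        same_param s (tau i (a + b * u))) ->
      same_param s (tau i u) -> forall v, -1 <= v <= 1 -> u <> a + b * v.
    by move=> n su v hv uv; apply: n; exists i, v; rewrite in_itv -uv.
  split=> [s n|s t ns nt].
    rewrite cD cD'; have [[i [u [hu su]]]|far] := pselect (near_arcs tau s).
      rewrite !(redraw_near c_chart _ hu su).
      by have [|-> _] := out i u _ (away _ _ _ n su);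
        first by rewrite in_itv in hu.
    by rewrite !redraw_far.
  rewrite oD oD'; split=> -[w|[i [u [q su tu]]]]; [by left| |by left|].
    have [_ e] := out i u (Qb' _ _ q) (away _ _ _ ns su).
    by right; exists i, u; split=> //; apply/e.
  have [_ e] := out i u (Qb _ _ q) (away _ _ _ ns su).
  by right; exists i, u; split=> //; apply/e.
Qed.

(** All classical crossings in the disc lie to the right of [u2], so that the part of arc [i] over
    [u1, u2] meets only virtual ones, before and after. *)
Lemma redrawn_detour f f' Q W D D' i u1 u2 :
  far_crossings W -> (forall j u, Q j u -> u2 < u <= 1) ->
  is_redrawn f Q W D -> is_redrawn f' Q W D' ->
  -1 <= u1 -> u1 < u2 -> u2 <= 1 ->
  (forall j u, -1 <= u <= 1 -> j <> i \/ ~ (u1 < u < u2) ->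
    f' j u = f j u) ->
  detour_move D D'.
Proof.
move=> fW Qb [cD oD] [cD' oD'] hu1 u12 hu2 agree.
have [_ ctau _ _ _] := c_chart.
have sub u : u1 <= u <= u2 -> u \in `[- 1, 1] by rewrite in_itv /=; lra.
have [_ _ _ Wf] := fW.
have [||a [b [ab im ends]]] := @arc_interval _ (tau i) _ _ u12.
- by apply: continuous_subspaceW (ctau i) => u /= hu; apply: sub;
    rewrite in_itv in hu.
- move=> u v /sub hu /sub hv h.
  by case: (chart_param_inj c_chart (i := i) (j :=
    i) hu hv (same_param_refl _) h).
exists a, b; split=> //.
- move=> D0 s t h /im[u [hu es]].
  have over0 x y : passes_over D0 x y <-> redrawn_over Q W x y.
    by case: h => ->.
  have ns : near_arcs tau s.
    by exists i, u; split; [exact: sub|rewrite es; exact: same_param_refl].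
  have noQ j k v : Q j v -> ~ same_param s (tau k v).
    move=> q sv; have /andP[v2 v1] := Qb _ _ q.
    have hv : v \in `[- 1, 1] by rewrite in_itv /=; lra.
    rewrite es in sv.
    have [_ uv] := chart_param_inj c_chart (sub _ hu) hv (same_param_refl _) sv.
    by move: hu; rewrite uv; lra.
  split=> /over0[w|[j [v [q sv tv]]]].
  + by case: (Wf _ _ w).
  + exact: noQ q sv.
  + by case: (Wf _ _ w).
  + exact: noQ q tv.
- move=> s hs; rewrite cD cD'.
  have [[j [v [hv sv]]]|n] := pselect (near_arcs tau s);
    last by rewrite !redraw_far.
  rewrite !(redraw_near c_chart _ hv sv) agree //.
  have [ji|] := pselect (j = i); last by left.
  right=> hv'; rewrite ji in sv.
  have hv2 : u1 <= v <= u2 by lra.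
  have tv : a <= tau i v <= b by apply/im; exists v.
  have inj w : u1 <= w <= u2 -> tau i v = tau i w -> v = w.
    move=> hw e; have sp : same_param (tau i v) (tau i w).
      by rewrite e; exact: same_param_refl.
    by case: (chart_param_inj c_chart (sub _ hv2) (sub _ hw)
      (same_param_refl _) sp).
  have e1 : u1 <= u1 <= u2 by lra.
  have e2 : u1 <= u2 <= u2 by lra.
  (* The interval [b, a + 1] meets this strand only in its ends, where [v] is [u1] or [u2], against
     the strict bounds in [hv']. *)
  have := same_param_complement ab tv hs sv.
  case: ends => -[-> ->] [] => [/(inj _ e1)|/(inj _ e2)|/(inj _ e2)|/(inj _
    e1)];
    by move: hv'; lra.
- by move=> s t; rewrite oD oD'.
Qed.

End RedrawnDiagrams.

(** * Crossings in the disc: R2 moves and detours of the bigons *)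

Section CrossingChange.
Variable R : realType.
Implicit Types (s t u v x y : R) (D : diagram R) (p q : R * R).

Definition upper_at (P0 P1 : R -> Prop) (i : 'I_2) u : Prop :=
  if i == ord0 then P0 u else P1 u.

Lemma near_crossings_upper f (P0 P1 : R -> Prop) :
  (forall u, P0 u \/ P1 u -> -1 <= u <= 1 /\ f ord0 u = f ord_max u) ->
  (forall u, P0 u -> ~ P1 u) -> near_crossings f (upper_at P0 P1).
Proof.
move=> h01 dis i u; case: (ord2P i) => ->;
  rewrite ?rev_ord0 ?rev_ord_max /upper_at /= => q.
- have [h1 h2] := h01 u (or_introl q); split=> //; exact: dis.
- have [h1 h2] := h01 u (or_intror q); split=> // /dis; exact.
Qed.

Definition none u : Prop := False.
Definition at_left u : Prop := u = - (2 / 3).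
Definition at_right u : Prop := u = 2 / 3.
Definition at_middle_right u : Prop := u = 0 \/ u = 2 / 3.
Definition at_all u : Prop := [\/ u = - (2 / 3), u = 0 | u = 2 / 3].

(** The crossings p, q, r are at -2/3, 0, 2/3, and arc 1 is the strand on top at p. Thus
    [crossing_left_under] is p before the switch and [crossing_left] after it;
    [three_crossings_alternating] follows the first R2 move, and [crossing_right] is what remains
    once p and q are virtual. *)
Definition crossing_left := upper_at at_left none.
Definition crossing_left_under := upper_at none at_left.
Definition crossing_right := upper_at at_right none.
Definition three_crossings := upper_at at_all none.
Definition three_crossings_alternating := upper_at at_middle_right at_left.

Lemma near_crossing_left : near_crossings (mirror (@zig_left R)) crossing_left.
Proof.
apply: near_crossings_upper => [u [->|[]]|u _ //].
by split; piecewise; lra.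
Qed.

Lemma near_crossing_left_under :
  near_crossings (mirror (@zig_left R)) crossing_left_under.
Proof.
apply: near_crossings_upper => [u [[]|->]|u []].
by split; piecewise; lra.
Qed.

Lemma near_three_crossings : near_crossings (mirror (@zigzag R))
  three_crossings.
Proof.
apply: near_crossings_upper => [u [[] ->|[]]|u _ //]; split; piecewise; lra.
Qed.

Lemma near_three_crossings_alternating :
  near_crossings (mirror (@zigzag R)) three_crossings_alternating.
Proof.
apply: near_crossings_upper => [u [[]->|->]|u [] ->].
- by split; piecewise; lra.
- by split; piecewise; lra.
- by split; piecewise; lra.
- by rewrite /at_left; lra.
- by rewrite /at_left; lra.
Qed.

Lemma near_crossing_right f :
  f ord0 (2 / 3) = f ord_max (2 / 3) -> near_crossings f crossing_right.
Proof.
by move=> e; apply: near_crossings_upper => [u [->|[]]|u _ //]; split=> //; lra.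
Qed.

Definition good_zig := good_redrawing (mirror (@zig_left R)).

Lemma good_zig_tame f : tame_graphs f ->
  (forall i, f i (-1) = mirror (@zig_left R) i (-1) /\
             f i 1 = mirror (@zig_left R) i 1) -> good_zig f.
Proof. by case=> cf bf _ ends; split. Qed.

Lemma zig_left_continuous i : continuous (mirror (@zig_left R) i).
Proof. by case: (ord2P i) => ->; rewrite /mirror /pair_fun /= /zig_left;
  continuity. Qed.

Lemma zig_left_bound i u : -1 <= u <= 1 -> -1 < mirror (@zig_left R) i u < 1.
Proof. by move=> hu; case: (ord2P i) => ->; piecewise; lra. Qed.

Lemma good_zig_left : good_zig (mirror (@zig_left R)).
Proof. by split; [exact: zig_left_continuous|exact: zig_left_bound|]. Qed.

Lemma good_zigzag : good_zig (mirror (@zigzag R)).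
Proof.
apply: good_zig_tame; first exact: tame_zigzag.
by move=> i; case: (ord2P i) => ->; split; piecewise; lra.
Qed.

Lemma good_low : good_zig (pair_fun (@low_right R) (fun x => - zigzag x)).
Proof.
apply: good_zig_tame; first exact: tame_low.
by move=> i; case: (ord2P i) => ->; split; piecewise; lra.
Qed.

Lemma good_low_right :
  good_zig (pair_fun (@low_right R) (fun x => - zig_right x)).
Proof.
apply: good_zig_tame; first exact: tame_low_right.
by move=> i; case: (ord2P i) => ->; split; piecewise; lra.
Qed.

Lemma good_right : good_zig (mirror (@zig_right R)).
Proof.
apply: good_zig_tame; first exact: tame_right.
by move=> i; case: (ord2P i) => ->; split; piecewise; lra.
Qed.

Lemma zigzag_out_right i u : -1 <= u <= 1 ->
  (forall v, -1 <= v <= 1 -> u <> 1 / 3 + 2 / 3 * v) ->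
  u < - (1 / 3) /\ mirror (@zigzag R) i u = mirror (@zig_left R) i u.
Proof.
move=> hu h; have lt_u : u < - (1 / 3).
  have [//|ge_u] := ltP u (- (1 / 3)).
  by case: (h ((u - 1 / 3) * (3 / 2))); lra.
by split=> //; case: (ord2P i) => ->; piecewise; lra.
Qed.

Lemma zigzag_out_left i u : -1 <= u <= 1 ->
  (forall v, -1 <= v <= 1 -> u <> - (1 / 3) + 2 / 3 * v) ->
  1 / 3 < u /\ mirror (@zigzag R) i u = mirror (@zig_right R) i u.
Proof.
move=> hu h; have lt_u : 1 / 3 < u.
  have [//|ge_u] := ltP (1 / 3) u.
  by case: (h ((u + 1 / 3) * (3 / 2))); lra.
by split=> //; case: (ord2P i) => ->; piecewise; lra.
Qed.

Lemma norm_half u : `|u| = 2^-1 <-> u = 2^-1 \/ u = - 2^-1.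
Proof.
split=> [|[] ->]; last 2 first.
- by rewrite gtr0_norm // invr_gt0.
- by rewrite normrN gtr0_norm // invr_gt0.
by case: (ger0P u) => _ h; [left|right]; lra.
Qed.

Section Disc.
Variables (c : R -> R * R) (phi : R * R -> R * R) (tau : 'I_2 -> R -> R).
Hypothesis c_generic : generic_closed_curve c.
Hypothesis c_chart : looks_like c (graphs (mirror (@zig_left R))) phi tau.
Variable W : R -> R -> Prop.
Hypothesis W_far : far_crossings c tau W.

Let is_redrawn f Q D := is_redrawn c phi tau f Q W D.
Let exists_redrawn f Q := @redrawn_exists R c phi tau _ c_generic c_chart
  zig_left_continuous zig_left_bound f Q W.

(** The new crossings 0 and 2/3 are the points 1/3 + 2/3 u with |u| = 1/2. *)
Lemma R2_adds_alternating D D' :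
  is_redrawn (mirror (@zig_left R)) crossing_left_under D ->
  is_redrawn (mirror (@zigzag R)) three_crossings_alternating D' ->
  equivalent D D'.
Proof.
move=> hD hD'; apply: rst_step; left; constructor 3.
apply: (redrawn_R2 c_generic c_chart good_zig_left good_zigzag W_far
  near_crossing_left_under near_three_crossings_alternating hD hD'
  (subpicture_left_R2 R) (subpicture_zigzag_R2 R)) => i u hu.
- move=> /(zigzag_out_right i hu)[lt_u ->]; split=> //.
  case: (ord2P i) => ->; rewrite /three_crossings_alternating
    /crossing_left_under /upper_at /= //.
  by split=> // -[] h; move: lt_u; rewrite h; lra.
- case: (ord2P i) => ->; rewrite /crossing_left_under /upper_at /= // /at_left;
    lra.
- case: (ord2P i) => ->; rewrite /three_crossings_alternating /upper_at /=.
    rewrite /at_middle_right norm_half; split=> [[] h|[_ [] ->]].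
    + by split=> //; right; lra.
    + by split=> //; left; lra.
    + by right; lra.
    + by left; lra.
  by rewrite /at_left; split=> [|[]//]; lra.
Qed.

Lemma R2_adds_two D D' : is_redrawn (mirror (@zig_left R)) crossing_left D ->
  is_redrawn (mirror (@zigzag R)) three_crossings D' -> equivalent D D'.
Proof.
move=> hD hD'; apply: rst_step; left; constructor 3.
apply: (redrawn_R2 c_generic c_chart good_zig_left good_zigzag W_far
  near_crossing_left near_three_crossings hD hD'
  (subpicture_left_R2 R) (subpicture_zigzag_R2 R)) => i u hu.
- move=> /(zigzag_out_right i hu)[lt_u ->]; split=> //.
  case: (ord2P i) => ->; rewrite /three_crossings /crossing_left /upper_at /=
    //.
  split=> [|h]; last by constructor 1.
  by case=> // h; move: lt_u; rewrite h; lra.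
- case: (ord2P i) => ->; rewrite /crossing_left /upper_at /= // /at_left; lra.
- case: (ord2P i) => ->; rewrite /three_crossings /upper_at /=;
    last by split=> [|[]].
  rewrite /at_all norm_half; split=> [[] h|[_ [] ->]].
  + by exfalso; lra.
  + by split=> //; right; lra.
  + by split=> //; left; lra.
  + by constructor 3; lra.
  + by constructor 2; lra.
Qed.

(** Read backwards, this cancels the crossings at -2/3 and 0, that is at - 1/3 + 2/3 u with |u| =
    1/2. *)
Lemma R2_leaves_right D D' : is_redrawn (mirror (@zig_right R))
  crossing_right D ->
  is_redrawn (mirror (@zigzag R)) three_crossings D' -> equivalent D D'.
Proof.
move=> hD hD'; apply: rst_step; left; constructor 3.
have near_right : near_crossings (mirror (@zig_right R)) crossing_right.
  by apply: near_crossing_right; piecewise; lra.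
apply: (redrawn_R2 c_generic c_chart good_right good_zigzag W_far
  near_right near_three_crossings hD hD'
  (subpicture_right_R2 R) (subpicture_zigzag_R2_flip R)) => i u hu.
- move=> /(zigzag_out_left i hu)[lt_u ->]; split=> //.
  case: (ord2P i) => ->; rewrite /three_crossings /crossing_right /upper_at /=
    //.
  split=> [|h]; last by constructor 3.
  by case=> // h; move: lt_u; rewrite h; lra.
- case: (ord2P i) => ->; rewrite /crossing_right /upper_at /= // /at_right; lra.
- case: (ord2P i) => ->; rewrite /three_crossings /upper_at /=;
    last by split=> [|[]].
  rewrite /at_all norm_half; split=> [[] h|[_ [] ->]].
  + by split=> //; right; lra.
  + by split=> //; left; lra.
  + by exfalso; lra.
  + by constructor 2; lra.
  + by constructor 1; lra.
Qed.

(** The only classical crossing in the disc is at 2/3, so that either arc may be redrawn freely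
    between -1 and 1/3. *)
Lemma detour_right f f' D D' i :
  is_redrawn f crossing_right D -> is_redrawn f' crossing_right D' ->
  (forall j u, -1 <= u <= 1 -> j <> i \/ ~ (-1 < u < 1 / 3) ->
    f' j u = f j u) -> equivalent D D'.
Proof.
move=> hD hD' agree; apply: rst_step; right.
apply: (redrawn_detour (i := i) (u1 := -1) (u2 :=
  1 / 3) c_chart W_far _ hD hD');
  [|lra..|exact: agree].
move=> j u; case: (ord2P j) => -> //;
  rewrite /crossing_right /upper_at /= /at_right => ->.
lra.
Qed.

(* R2 moves a crossing from the left to the right, through three parallel
   crossings; and if the left two of these are virtual, detours remove them. *)
Lemma one_of_three D D' :
  is_redrawn (mirror (@zigzag R)) crossing_right D ->
  is_redrawn (mirror (@zig_left R)) crossing_left D' -> equivalent D D'.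
Proof.
move=> hD hD'.
have [E1 hE1] := exists_redrawn good_zigzag (tame_zigzag R)
  W_far near_three_crossings.
have n2 : near_crossings (mirror (@zig_right R)) crossing_right.
  by apply: near_crossing_right; piecewise; lra.
have n3 : near_crossings (pair_fun (@low_right R) (fun x =>
  - zigzag x)) crossing_right.
  by apply: near_crossing_right; piecewise; lra.
have n4 : near_crossings (pair_fun (@low_right R) (fun x =>
  - zig_right x)) crossing_right.
  by apply: near_crossing_right; piecewise; lra.
have [E2 hE2] := exists_redrawn good_right (tame_right R) W_far n2.
have [E3 hE3] := exists_redrawn good_low (tame_low R) W_far n3.
have [E4 hE4] := exists_redrawn good_low_right (tame_low_right R) W_far n4.
have D'E1 := R2_adds_two hD' hE1.
have E2E1 := R2_leaves_right hE2 hE1.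
(* Three detours lead from [zigzag] to [zig_right]: arc 0 goes down to [low_right], arc 1 is
   straightened above it, and arc 0 is straightened in turn. *)
have DE3 : equivalent D E3.
  apply: (detour_right (i := ord0) hD hE3) => j u hu.
  case: (ord2P j) => -> // -[//|h]; piecewise; lra.
have E3E4 : equivalent E3 E4.
  apply: (detour_right (i := ord_max) hE3 hE4) => j u hu.
  case: (ord2P j) => -> // -[//|h]; piecewise; lra.
have E4E2 : equivalent E4 E2.
  apply: (detour_right (i := ord0) hE4 hE2) => j u hu.
  case: (ord2P j) => -> // -[//|h]; piecewise; lra.
apply: (rst_trans _ _ _ _ _ DE3); apply: (rst_trans _ _ _ _ _ E3E4).
apply: (rst_trans _ _ _ _ _ E4E2); apply: (rst_trans _ _ _ _ _ E2E1).
exact: rst_sym.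
Qed.

End Disc.
End CrossingChange.

(** * Trading one switch for two virtualizations *)

Section OneCrossing.
Variable R : realType.
Implicit Types (s t u v x y : R) (D : diagram R) (p q : R * R).

Definition far_part (tau : 'I_2 -> R -> R) D s t : Prop :=
  passes_over D s t /\ ~ near_arcs tau s /\ ~ near_arcs tau t.

Lemma far_part_crossings tau D : far_crossings (curve D) tau (far_part tau D).
Proof.
split.
- by move=> s t [/passes_over_double].
- by move=> s t [/passes_over_asym o _] [].
- move=> s s' t t' es et [w [ns nt]]; split; first exact: passes_over_param w.
  split; first by move=> /(near_arcs_param (same_param_sym es)).
  by move=> /(near_arcs_param (same_param_sym et)).
- by move=> s t [].
Qed.

(** Both parameters sit at the centre of a crossing chart, on different arcs. After a swap, if
    necessary, the upper strand is arc 1, and [subpicture_zig_left] bends the axes into the two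
    graphs. *)
Lemma crossing_chart D s0 t0 : passes_over D s0 t0 -> exists phi tau,
  [/\ looks_like (curve D) (graphs (mirror (@zig_left R))) phi tau,
      same_param s0 (tau ord_max (- (2 / 3))),
        same_param t0 (tau ord0 (- (2 / 3)))
    & phi (- (2 / 3), 0) = curve D s0].
Proof.
move=> /passes_over_double st; have [e n] := st.
have [_ per _ cross] := curve_generic D.
have [phi [tau [ch phi0]]] := cross _ _ st.
have center s : curve D s = phi (0, 0) -> exists i, same_param s (tau i 0).
  move=> es; have [hphi _ eqc _ out] := ch.
  have [|i [u [hu su]]] := out s.
    by rewrite es; exists (0, 0) => //; split=> /=; lra.
  exists i; suff u0 : u = 0 by rewrite -u0.
  move: es; rewrite (periodic_same_param per su) eqc // => /(homeo_inj hphi).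
  by case: (ord2P i) => -> /= [].
suff [phi1 [tau1 [ch1 phi10 s1 t1]]] : exists phi1 tau1,
    [/\ looks_like (curve D) (crossing_picture R) phi1 tau1,
        phi1 (0, 0) = curve D s0,
        same_param s0 (tau1 ord_max 0) & same_param t0 (tau1 ord0 0)].
  have [psi [psi0 sub]] := subpicture_zig_left R.
  exists (phi1 \o psi), (fun i u => tau1 (id i) (1 / 4 + 3 / 8 * u)).
  have z0 : 1 / 4 + 3 / 8 * - (2 / 3) = 0 :> R by field.
  by split; rewrite ?z0 //= ?psi0 //; exact: looks_like_sub per ch1 sub.
have [i si] := center s0 (esym phi0).
have [j tj] := center t0 (etrans (esym e) (esym phi0)).
case: (ord2P i) (ord2P j) si tj => -> [] -> si tj.
- by case: n; exact: same_param_trans si (same_param_sym tj).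
- exists (phi \o (fun p => (p.2, p.1))),
    (fun i u => tau (rev_ord i) (0 + 1 * u)).
  split=> //=; rewrite ?mulr0 ?addr0 ?rev_ord0 ?rev_ord_max //.
  exact: looks_like_sub per ch (subpicture_swap R).
- by exists phi, tau.
- by case: n; exact: same_param_trans si (same_param_sym tj).
Qed.

Section AtCrossing.
Variables (D : diagram R) (phi : R * R -> R * R) (tau : 'I_2 -> R -> R).
Hypothesis chart : looks_like (curve D) (graphs (mirror (@zig_left R))) phi tau.
Let D_generic := curve_generic D.

Lemma self_redrawn : redraw (curve D) phi tau (mirror (@zig_left R)) = curve D.
Proof. by apply/funext => s; exact: redraw_same D_generic chart _ _ _. Qed.

Hypothesis over_max : passes_over D (tau ord_max (- (2 / 3)))
  (tau ord0 (- (2 / 3))).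

(** The two graphs meet only at -2/3, so that any other crossing has both its parameters off the
    arcs. *)
Lemma D_redrawn : is_redrawn (curve D) phi tau (mirror (@zig_left R))
  (@crossing_left_under R) (far_part tau D) D.
Proof.
have [hphi _ _ _ out] := chart.
split; first by rewrite self_redrawn.
move=> s t; split=> [w|[[]//|[i [u []]]]]; last first.
  case: (ord2P i) => -> //; rewrite /crossing_left_under /upper_at /= /at_left
    rev_ord_max.
  move=> -> es et; exact: passes_over_param (same_param_sym es)
    (same_param_sym et) over_max.
have [e n] := passes_over_double w.
have indisc r : near_arcs tau r -> (phi @` @square R) (curve D r).
  by move=> /(redraw_in_disc chart (good_zig_left R)); rewrite self_redrawn.
have [[i [u [hu su]]]|ns] := pselect (near_arcs tau s); last first.
  left; split=> //; split=> // /indisc; rewrite -e; exact: (chart_far chart ns).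
have /out[j [v [hv tv]]] : (phi @` @square R) (curve D t) by rewrite -e;
  apply: indisc; exists i, u.
right; move: e; rewrite (chart_arc D_generic chart hu su)
  (chart_arc D_generic chart hv tv).
move=> /(homeo_inj hphi)/pair_equal_spec[uv]; rewrite -uv in tv *.
have zero : zig_left u = - zig_left u -> u = - (2 / 3) by piecewise; lra.
case: (ord2P i) (ord2P j) su tv => -> [] -> su tv.
- by case: n; exact: same_param_trans su (same_param_sym tv).
- move=> /zero uE; rewrite uE in su tv; exfalso.
  by have := passes_over_param su tv w => /passes_over_asym; apply.
- move=> /esym/zero uE; exists ord_max, u; rewrite rev_ord_max; split=> //.
- by case: n; exact: same_param_trans su (same_param_sym tv).
Qed.

End AtCrossing.

(** The disc contains no classical crossing of [D] but p, so that changes at the other crossings,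
    [S] and [V], do not interfere with redrawing it. Allowing for them makes an induction over the
    crossings possible, in which [q], being new, differs from all crossings still to be switched. *)
Lemma change_crossing D p : classical_crossings D p -> exists D1 q,
  [/\ equivalent D D1, classical_crossings D `<=` classical_crossings D1,
      classical_crossings D1 q, ~ classical_crossings D q
    & forall S V : set (R * R),
        S `<=` classical_crossings D -> V `<=` classical_crossings D ->
        ~ S p -> ~ V p ->
        equivalent
          (virtualize_crossings (switch_crossings D1 S) ([set p; q] `|` V))
          (virtualize_crossings (switch_crossings D ([set p] `|` S)) V)].
Proof.
move=> [s0 [t0 [w0 ->]]]; set p0 := curve D s0.
have neq_lr : 2 / 3 <> - (2 / 3) :> R by lra.
have neq_0r : 2 / 3 <> 0 :> R by lra.
have neq_0l : 0 <> - (2 / 3) :> R by lra.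
have zl : zig_left (- (2 / 3)) = 0 :> R by piecewise; lra.
have zz0 : zigzag 0 = 0 :> R by piecewise; lra.
have zzl : zigzag (- (2 / 3)) = 0 :> R by piecewise; lra.
have zzr : zigzag (2 / 3) = 0 :> R by piecewise; lra.
have hl : -1 <= - (2 / 3 : R) <= 1 by lra.
have hr : -1 <= (2 / 3 : R) <= 1 by lra.
have h0 : -1 <= (0 : R) <= 1 by lra.
have [phi [tau [ch s1 t1 phip]]] := crossing_chart w0.
have Dgen := curve_generic D.
have hD := D_redrawn ch (passes_over_param s1 t1 w0).
have fW := far_part_crossings tau D.
have [D1 hD1] := redrawn_exists Dgen ch (@zig_left_continuous R)
  (@zig_left_bound R)
  (good_zigzag R) (tame_zigzag R) fW (@near_three_crossings_alternating R).
have [hphi _ _ _ out] := ch.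
pose disc : set (R * R) := phi @` @square R; pose q := phi (0, 0).
have [_ oD] := hD; have [cD1 oD1] := hD1.
have cnear i u s : -1 <= u <= 1 -> same_param s (tau i u) ->
    curve D s = phi (u, mirror (@zig_left R) i u).
  by move=> hu su; exact: (chart_arc Dgen ch (u := u)).
have c1near i u s : -1 <= u <= 1 -> same_param s (tau i u) ->
    curve D1 s = phi (u, mirror (@zigzag R) i u).
  by move=> hu su; rewrite cD1; exact: (redraw_near ch _ (u := u)).
have c1far s : ~ near_arcs tau s -> curve D1 s = curve D s.
  by rewrite cD1; exact: redraw_far.
have far_disc s : ~ near_arcs tau s -> ~ disc (curve D s)
  by exact: (chart_far ch).
have indisc x y : -1 <= x <= 1 -> -1 <= y <= 1 -> disc (phi (x, y)).
  by move=> hx hy; exists (x, y).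
have discp : disc p0 by rewrite /p0 -phip; exact: indisc.
have discq : disc q by exact: indisc.
have mz g i x : g x = 0 -> mirror g i x = 0 :> R.
  by move=> e; case: (ord2P i) => ->; rewrite /mirror /pair_fun /= e ?oppr0.
have cc_disc (x : R * R) : classical_crossings D x -> disc x -> x = p0.
  move=> [s [t [/oD w ->]]]; case: w => [[_ [ns _]]|[i [u [qu su tu]]]].
    by move/(far_disc s ns).
  move: qu su; case: (ord2P i) => -> // -> su _.
  by rewrite (cnear _ _ _ hl su) mz // phip.
have left_over s t : passes_over D s t -> near_arcs tau s \/ near_arcs tau t ->
    same_param s (tau ord_max (- (2 / 3))) /\
      same_param t (tau ord0 (- (2 / 3))).
  move=> /oD[[_ [ns nt]] []//|[i [u [qu su tu]]]] _.
  by move: qu su tu; case: (ord2P i) => -> // ->; rewrite rev_ord_max.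
exists D1, q; split.
- exact: (R2_adds_alternating Dgen ch fW hD hD1).
- move=> x [s [t [w ->]]].
  have [ns|ns] := pselect (near_arcs tau s).
    have [su tu] := left_over _ _ w (or_introl ns).
    exists s, t; split; last by rewrite (cnear _ _ _ hl su)
      (c1near _ _ _ hl su) !mz.
    by apply/oD1; right; exists ord_max, (- (2 / 3)); rewrite rev_ord_max.
  exists s, t; split; last by rewrite c1far.
  by apply/oD1; left; move/oD: w => [//|[i [u [qu su _]]]]; case: ns;
    exists i, u;
    split=> //; have [] := @near_crossing_left_under R i u qu.
- exists (tau ord0 0), (tau ord_max 0); split.
    apply/oD1; right; exists ord0, 0; rewrite rev_ord0.
    by split; [left|exact: same_param_refl..].
  by rewrite (c1near ord0 0) ?mz //; exact: same_param_refl.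
- move=> /cc_disc/(_ discq).
  by rewrite /q /p0 -phip => /(homeo_inj hphi)/pair_equal_spec[/neq_0l].
move=> S V SD VD Sp Vp.
have Sdisc (x : R * R) : disc x -> ~ S x.
  by move=> dx Sx; apply: Sp; rewrite -(cc_disc x (SD _ Sx) dx).
have Vdisc (x : R * R) : disc x -> ~ V x.
  by move=> dx Vx; apply: Vp; rewrite -(cc_disc x (VD _ Vx) dx).
(* Away from the disc, both diagrams to be compared have the crossings of [F]. *)
pose F := virtualize_crossings (switch_crossings D S) V.
have fW' : far_crossings (curve D) tau (far_part tau F) :=
  far_part_crossings tau F.
have near_disc s : near_arcs tau s -> disc (curve D s).
  by move=> /(redraw_in_disc ch (good_zig_left R)); rewrite self_redrawn.
have not_near i u s : -1 <= u <= 1 -> same_param s (tau i u) -> near_arcs tau s.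
  by move=> hu su; exists i, u.
have far_neq s (x : R * R) : ~ near_arcs tau s -> disc x -> curve D s <> x.
  by move=> ns dx e; apply: (far_disc s ns); rewrite e.
have over_far s t : ~ near_arcs tau s \/ ~ near_arcs tau t ->
    passes_over D1 s t <-> far_part tau D s t.
  move=> nst; split=> [/oD1[//|[i [u [qu su tu]]]]|w]; last by apply/oD1; left.
  have [hu _ _] := @near_three_crossings_alternating R i u qu.
  by case: nst; case; [exact: not_near su|exact: not_near tu].
have over_far_D s t : ~ near_arcs tau s \/ ~ near_arcs tau t ->
    passes_over D s t -> far_part tau D s t.
  move=> nst /oD[//|[i [u [qu su tu]]]].
  have [hu _ _] := @near_crossing_left_under R i u qu.
  by case: nst; case; [exact: not_near su|exact: not_near tu].
(* In the disc, the first diagram has kept only r, and the second one has p with arc 0 on top. *)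
apply: (one_of_three Dgen ch fW').
- split=> // s t; split.
  + move=> [/= nV sw]; have [ns|ns] := pselect (near_arcs tau s).
      have ds : disc (curve D1 s).
        by rewrite cD1; exact: (redraw_in_disc ch (good_zigzag R)).
      have {sw} : passes_over D1 s t by case: sw => [[_ //]|[/(Sdisc _ ds)]].
      move=> /oD1[[_ [nns _]]//|[i [u [qu su tu]]]].
      have [hu _ _] := @near_three_crossings_alternating R i u qu.
      move: nV; rewrite (c1near i u s) // => nV; right; exists i, u; split=> //.
      move: qu nV; case: (ord2P i) => ->; rewrite /crossing_right
        /three_crossings_alternating /upper_at /=.
        by move=> [->|//] []; left; right; rewrite mz.
      by move=> -> []; left; left; rewrite mz // /p0 -phip.
    move: nV sw; rewrite /switched_over /= c1far // => nV sw.
    have nVs : ~ V (curve D s) by move=> Vs; apply: nV; right.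
    left; case: sw => -[Ss].
    * by move=> /(over_far _ _ (or_introl ns))[w [_ nt]]; split=> //;
        split=> //; left.
    * by move=> /(over_far _ _ (or_intror ns))[w [nt _]]; split=> //;
        split=> //; right.
  + case=> [[[nV sw] [ns nt]]|[i [u [qu su tu]]]].
      split=> /=; first by rewrite c1far // =>
        -[[/(far_neq _ _ ns discp)|/(far_neq _ _ ns discq)]|].
      rewrite /switched_over c1far //; case: sw => -[Ss w]; [left|right];
        split=> //.
        by apply/(over_far _ _ (or_introl ns)).
      by apply/(over_far _ _ (or_intror ns)).
    move: qu su tu; case: (ord2P i) => -> //; rewrite rev_ord0 => -> su tu.
    have e1 : curve D1 s = phi (2 / 3, 0) by rewrite (c1near _ _ _ hr su) mz.
    have d1 : disc (curve D1 s) by rewrite e1; exact: indisc.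
    split=> /=.
      move=> [[]|]; last exact: Vdisc d1.
        by rewrite e1 /p0 -phip => /(homeo_inj hphi)/pair_equal_spec[/neq_lr].
      by rewrite e1 => /(homeo_inj hphi)/pair_equal_spec[/neq_0r].
    left; split; first exact: Sdisc d1.
    by apply/oD1; right; exists ord0, (2 / 3); rewrite rev_ord0; split=> //;
      right.
- split; first by rewrite self_redrawn.
  move=> s t; split.
  + move=> [/= nV sw]; have [ns|ns] := pselect (near_arcs tau s).
      right; exists ord0, (- (2 / 3)); rewrite rev_ord0.
      case: sw => -[Ss w].
        have [su _] := left_over _ _ w (or_introl ns).
        by case: Ss; left; rewrite (cnear _ _ _ hl su) mz // phip.
      by have [tu su] := left_over _ _ w (or_intror ns).
    left; case: sw => -[Ss].
    * move=> /(over_far_D _ _ (or_introl ns))[w [_ nt]]; split=> //;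
        split=> //; left.
      by split=> // Ss'; apply: Ss; right.
    * move=> /(over_far_D _ _ (or_intror ns))[w [nt _]]; split=> //;
        split=> //; right.
      by split=> //; case: Ss => // /(far_neq _ _ ns discp).
  + case=> [[[nV sw] [ns nt]]|[i [u [qu su tu]]]].
      split=> //; case: sw => -[Ss w]; [left|right]; split=> //; last by right.
      by move=> [/(far_neq _ _ ns discp)|].
    move: qu su tu; case: (ord2P i) => -> //; rewrite rev_ord0 => -> su tu.
    have e1 : curve D s = p0 by rewrite (cnear _ _ _ hl su) mz // phip.
    split=> /=; first by rewrite e1.
    right; split; first by left.
    apply: passes_over_param w0; first exact: same_param_trans s1
      (same_param_sym tu).
    exact: same_param_trans t1 (same_param_sym su).
Qed.

End OneCrossing.

(** * Induction over the switched crossings, and the inequality *)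

Section Unknotting.
Variable R : realType.
Implicit Types D : diagram R.

(** The constant isotopy makes an equality of records, with their proof fields, unnecessary. *)
Lemma same_diagram_equivalent D D' : curve D = curve D' ->
  (forall s t, passes_over D s t <-> passes_over D' s t) -> equivalent D D'.
Proof.
move=> eqc eqo; apply: rst_step; left; constructor 1.
exists (fun _ p => p), id; split.
- split=> //; last by move=> t _; exact: homeo_id.
  by apply: continuous_subspaceT; exact: continuous_snd.
- by split=> [||]; [exact: continuous_id| |left].
- by move=> t; rewrite eqc.
- by move=> s t; rewrite eqo.
Qed.

Lemma set_cons (T : eqType) (x : T) (s : seq T) :
  [set` x :: s] = [set x] `|` [set` s].
Proof.
apply/seteqP; split=> y /=; rewrite inE.
  by case/orP => [/eqP|]; [left|right].
by case=> [->|ys]; [rewrite eqxx|rewrite ys orbT].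
Qed.

Lemma card_set_uniq (T : choiceType) (s : seq T) :
  uniq s -> ([set` s] #= `I_(size s))%card.
Proof.
elim: s => [_|x s IH /= /andP[xs us]].
  by rewrite (_ : [set` [::]] = set0) ?II0 //; apply/seteqP; split.
apply/eq_cardSP; exists x; first by rewrite /= mem_head.
rewrite (_ : _ `\ x = [set` s]); first exact: IH.
rewrite set_cons; apply/seteqP; split=> y /=; first by case=> -[].
by move=> ys; split; [right|move=> yx; rewrite -yx ys in xs].
Qed.

(** By induction on [ss], with [vs] the crossings already made virtual: each switch is replaced by
    two more entries of [vs], at the price of another diagram of the same knot. *)
Lemma virtualize_for_switch (ss : seq (R * R)) D (vs : seq (R * R)) :
  uniq ss -> (forall x, x \in ss -> classical_crossings D x) ->
  (forall x, x \in vs -> classical_crossings D x) ->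
  (forall x, x \in ss -> x \notin vs) ->
  exists D' vs', [/\ equivalent D D',
    forall x, x \in vs' -> classical_crossings D' x,
    size vs' = (size vs + 2 * size ss)%N
    & equivalent (virtualize_crossings D' [set` vs'])
        (virtualize_crossings (switch_crossings D [set` ss]) [set` vs])].
Proof.
elim: ss D vs => [|p ss IH] D vs /=.
  move=> _ _ Dvs _; exists D, vs; split=> //; first exact: rst_refl.
    by rewrite muln0 addn0.
  apply: same_diagram_equivalent => // s t.
  rewrite /= /kept_over /= /switched_over /=; split=> -[nV w]; split=> //.
    by left.
  by case: w => -[].
move=> /andP[pss uss] Dss Dvs dis.
have [D1 [q [DD1 sub D1q nDq E]]] := change_crossing (Dss p (mem_head _ _)).
(* The remaining crossings of [ss] are still crossings of [D1], and they differ from [p] by [uniq]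
   and from [q] because [q] is not a crossing of [D]. *)
have [|||D' [vs' [D1D' Dvs' szvs' E']]] := IH D1 [:: p, q & vs] uss.
- by move=> x xs; apply: sub; apply: Dss; rewrite inE xs orbT.
- move=> x; rewrite !inE => /or3P[/eqP->|/eqP->//|/Dvs/sub//].
  by apply: sub; apply: Dss; exact: mem_head.
- move=> x xs; have xps : x \in p :: ss by rewrite inE xs orbT.
  rewrite !inE !negb_or dis // andbT; apply/andP; split.
    by apply: contraNneq pss => <-.
  by apply/eqP => xq; apply: nDq; rewrite -xq; exact: Dss.
exists D', vs'; split=> //.
- exact: rst_trans DD1 D1D'.
- by rewrite szvs' /= mulnS addnA addn2 !addSn.
- apply: (rst_trans _ _ _ _ _ E'); rewrite !set_cons setUA; apply: E.
  + by move=> x /= xs; apply: Dss; rewrite inE xs orbT.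
  + by move=> x /= /Dvs.
  + exact/negP.
  + by apply/negP; apply: dis; exact: mem_head.
Qed.

Lemma virtual_unknotting_number_le K D (S : set (R * R)) n :
  is_virtual_knot K -> K D -> S `<=` classical_crossings D ->
  (S #= `I_n)%card -> is_unknot (switch_crossings D S) ->
  (virtual_unknotting_number K <= (2 * n)%:R%:E)%E.
Proof.
move=> [D0 KE] KD SD Sn unk.
have [ss0 Sss0] : exists s : seq (R * R), S = [set` s].
  by apply/finite_seqP; exists n.
pose ss := undup ss0.
have Sss : S = [set` ss].
  by rewrite Sss0; apply/seteqP; split=> x /=; rewrite mem_undup.
have szss : size ss = n.
  apply/card_eq_II; rewrite -(card_eqr Sn) card_eq_sym Sss.
  by apply: card_set_uniq; exact: undup_uniq.
have [|||D' [vs [DD' D'vs szvs E]]] :=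
  @virtualize_for_switch ss D [::] (undup_uniq _).
- by move=> x xs; apply: SD; rewrite Sss.
- by [].
- by [].
have KD' : K D' by rewrite KE in KD *; exact: rst_trans KD DD'.
apply: ge_ereal_inf; exists (virtual_unknotting_number_diagram D').
  by exists D'.
(* [vs] is not known to be free of repetitions, so its length only bounds the number of crossings
   made virtual. *)
apply: ge_ereal_inf; exists (size (undup vs))%:R%:E; last first.
  by rewrite lee_fin ler_nat (leq_trans (size_undup vs)) // szvs szss.
exists (size (undup vs)), [set` undup vs]; split=> //.
- by move=> x /=; rewrite mem_undup; exact: D'vs.
- by apply: card_set_uniq; exact: undup_uniq.
- have -> : [set` undup vs] = [set` vs].
    by apply/seteqP; split=> x /=; rewrite mem_undup.
  apply: (rst_trans _ _ _ _ _ unk); apply: rst_sym.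
  apply: (rst_trans _ _ _ _ _ E); rewrite -Sss.
  apply: same_diagram_equivalent => // s t.
  by rewrite /= /kept_over /=; split=> [[]|].
Qed.

End Unknotting.

Theorem theorem7p6 (R : realType) (K : set (diagram R)) :
  is_virtual_knot K ->
  (virtual_unknotting_number K <= 2%:E * unknotting_number K)%E.
Proof.
(* With the factor 2 moved to the left, it suffices to bound every member of the two nested infima
   from below; an empty one is +oo and needs no separate case. *)
move=> hK; rewrite -lee_pdivrMl //.
apply/ereal_infP => _ [D KD <-]; apply/ereal_infP => _ [n [S [SD Sn unk ->]]].
rewrite lee_pdivrMl // -EFinM -natrM.
exact: virtual_unknotting_number_le SD Sn unk.
Qed.
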